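(* $(\mathrm{Mod}(T_2),\cong)$ is Borel reducible to $(\mathrm{Mod}(\mathrm K),\cong)$.
   Context: $\mathrm{Mod}(\Phi)$ is the set of models of $\Phi$ with universe $\omega$, a standard Borel space with the usual logic topology. A Borel reduction from $(\mathrm{Mod}(\Phi),\cong)$ to $(\mathrm{Mod}(\Psi),\cong)$ is a Borel map $f$ with $M\cong N\iff f(M)\cong f(N)$. $\mathrm K$ (Koerwien's theory), in multisorted first-order logic (no unsorted elements), has sorts $U$, $V_i$, $C_i$ ($i\in\omega$) and unary functions $S_i$, $\pi_i^j$ ($i\in\omega$, $j\le i+1$), with axioms: the sorts are disjoint; $U$ and each $V_i$ are infinite and each $C_i$ has size 2; $\pi_i^{i+1}:V_i\to U$, and $\pi_i^j:V_i\to C_j$ for $j\le i$; writing $\pi_i=\pi_i^0\times\cdots\times\pi_i^{i+1}:V_i\to C_0\times\cdots\times C_i\times U$, every fiber $\pi_i^{-1}(\bar c,u)$ is nonempty; $S_i:V_i\to V_i$ is a successor function (a bijection without finite cycles) with $\pi_i\circ S_i=\pi_i$. Jump: for a theory $\Phi$ in a countable relational language $L$, $J(\Phi)$ is the theory in $L\cup\{E\}$ ($E$ a new binary symbol) saying that $E$ is an equivalence relation with infinitely many classes, each class is (as an $L$-structure) a model of $\Phi$, and $R(\bar x)$ is false for $R\in L$ whenever $\bar x$ is not contained in a single $E$-class. $T_0$ is the complete theory of $(\mathbb Z,S)$ with $S$ the graph of successor, $T_1=J(T_0)$, $T_2=J(T_1)$. ($T_2$ is Borel bireducible with the relation $F_2$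 on $(2^\omega)^\omega$ of enumerating the same countable set of reals.) *)

(* Defs.v *)
From HB Require Import structures.
From mathcomp Require Import all_boot all_order all_algebra.
From mathcomp Require Import boolp classical_sets topology measure.

Set Implicit Arguments.
Unset Strict Implicit.
Unset Printing Implicit Defensive.

Local Open Scope classical_set_scope.

(** * Multisorted first-order logic *)

Record language := Language {
  lsort : countType;
  fsym : countType;
  farity : fsym -> nat;
  fdom : forall f, 'I_(farity f) -> lsort;
  fcod : fsym -> lsort;
  rsym : countType;
  rarity : rsym -> nat;
  rdom : forall R, 'I_(rarity R) -> lsort }.
Arguments fdom {l} f _.
Arguments rdom {l} R _.

Record interpretation (L : language) (X : lsort L -> Type) := Interpretation {
  fint : forall f : fsym L, (forall i, X (fdom f i)) -> X (fcod f);
  rint : forall R : rsym L, (forall i, X (rdom R i)) -> Prop }.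
Arguments fint {L X} _ f _.
Arguments rint {L X} _ R _.

Record structure (L : language) := Structure {
  carrier :> lsort L -> Type;
  interp : interpretation carrier }.
Arguments interp {L} _.

Definition isomorphic (L : language) (M N : structure L) : Prop :=
  exists h : forall s, M s -> N s,
  [/\ forall s, bijective (h s),
      forall f a, h (fcod f) (fint (interp M) f a) =
                  fint (interp N) f (fun i => h (fdom f i) (a i)) &
      forall R a, rint (interp M) R a <->
                  rint (interp N) R (fun i => h (rdom R i) (a i))].

(* A context is a type [V] of free variables together with their sorts.
   Quantifiers bind a finite block of variables at once: under [All g] and
   [Ex g], with [g : 'I_n -> S], the variable [inr i] has sort [g i] and [inl v]
   is the variable [v] of the surrounding context. *)
Definition ctx_cat (S V : Type) (G : V -> S) n (g : 'I_n -> S)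
    (v : V + 'I_n) : S :=
  match v with inl w => G w | inr i => g i end.

Definition val_cat (S V : Type) (X : S -> Type) (G : V -> S) n (g : 'I_n -> S)
    (r : forall v, X (G v)) (a : forall i, X (g i)) v : X (ctx_cat G g v) :=
  match v with inl w => r w | inr i => a i end.

Inductive term (L : language) (V : Type) (G : V -> lsort L) : lsort L -> Type :=
| Var (v : V) : term G (G v)
| App (f : fsym L) (ts : forall i, term G (fdom f i)) : term G (fcod f).
Arguments Var {L V G} v.
Arguments App {L V G} f ts.

Inductive formula (L : language) (V : Type) (G : V -> lsort L) : Type :=
| Eq (s : lsort L) (t u : term G s)
| Rel (R : rsym L) (ts : forall i, term G (rdom R i))
| Bot
| And (p q : formula G)
| Or (p q : formula G)
| Imp (p q : formula G)
| All (n : nat) (g : 'I_n -> lsort L) (p : formula (ctx_cat G g))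
| Ex (n : nat) (g : 'I_n -> lsort L) (p : formula (ctx_cat G g)).
Arguments Eq {L V G s} & t u.
Arguments Rel {L V G} & R ts.
Arguments Bot {L V G}.
Arguments And {L V G} & p q.
Arguments Or {L V G} & p q.
Arguments Imp {L V G} & p q.
Arguments All {L V G n} g & p.
Arguments Ex {L V G n} g & p.

Definition Not (L : language) V (G : V -> lsort L) (p : formula G) := Imp p Bot.
Arguments Not {L V G} & p.

Definition Conj (L : language) V (G : V -> lsort L) n
    (p : 'I_n -> formula G) : formula G :=
  foldr And (Imp Bot Bot) [seq p i | i <- enum 'I_n].
Arguments Conj {L V G n} & p.

Definition empty_ctx (S : Type) (v : void) : S := match v with end.

Definition sentence (L : language) := formula (@empty_ctx (lsort L)).

Definition theory (L : language) := set (sentence L).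

Fixpoint term_eval (L : language) (M : structure L) V (G : V -> lsort L)
    (r : forall v, M (G v)) s (t : term G s) : M s :=
  match t in term _ s return M s with
  | Var v => r v
  | App f ts => fint (interp M) f (fun i => term_eval r (ts i))
  end.

Fixpoint sat (L : language) (M : structure L) V (G : V -> lsort L)
    (p : formula G) : (forall v, M (G v)) -> Prop :=
  match p with
  | Eq s t u => fun r => term_eval r t = term_eval r u
  | Rel R ts => fun r => rint (interp M) R (fun i => term_eval r (ts i))
  | Bot => fun r => False
  | And p q => fun r => sat p r /\ sat q r
  | Or p q => fun r => sat p r \/ sat q r
  | Imp p q => fun r => sat p r -> sat q r
  | All n g p => fun r => forall a : forall i, M (g i), sat p (val_cat r a)
  | Ex n g p => fun r => exists a : forall i, M (g i), sat p (val_cat r a)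
  end.

Definition holds (L : language) (M : structure L) (p : sentence L) : Prop :=
  sat (M := M) p (fun v => match v with end).

Definition models (L : language) (M : structure L) (Phi : theory L) : Prop :=
  forall p, Phi p -> holds M p.

Definition complete_theory (L : language) (M : structure L) : theory L :=
  [set p | holds M p].

(** * Structures with universe omega, and Borel reductions *)

(* Every natural number has exactly one sort, so the sorts are disjoint and
   there are no unsorted elements. *)
Definition part (S : countType) (srt : nat -> S) (s : S) : Type :=
  {n : nat | srt n == s}.

Record omega_structure (L : language) := OmegaStructure {
  osort : nat -> lsort L;
  ointerp : interpretation (part osort) }.

Definition structure_of_omega (L : language) (M : omega_structure L) :
  structure L := Structure (ointerp M).
Coercion structure_of_omega : omega_structure >-> structure.

Definition Mod (L : language) (Phi : theory L) : Type :=
  {M : omega_structure L | models M Phi}.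

Definition Mod_structure (L : language) (Phi : theory L) (M : Mod Phi) :
  omega_structure L := proj1_sig M.
Coercion Mod_structure : Mod >-> omega_structure.

Inductive atomic_fact (L : language) : Type :=
| SortFact (n : nat) (s : lsort L)
| FunFact (f : fsym L) (a : 'I_(farity f) -> nat) (b : nat)
| RelFact (R : rsym L) (a : 'I_(rarity R) -> nat).

Definition fact_holds (L : language) (M : omega_structure L)
    (F : atomic_fact L) : Prop :=
  match F with
  | SortFact n s => osort M n = s
  | FunFact f a b => exists c : forall i, M (fdom f i),
      (forall i, sval (c i) = a i) /\ sval (fint (interp M) f c) = b
  | RelFact R a => exists c : forall i, M (rdom R i),
      (forall i, sval (c i) = a i) /\ rint (interp M) R c
  end.

Definition logic_subbase (L : language) (Phi : theory L) :
    set (set (Mod Phi)) :=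
  [set A | exists F : atomic_fact L,
     A = [set M : Mod Phi | fact_holds M F] \/
     A = [set M : Mod Phi | ~ fact_holds M F]].

HB.instance Definition _ (L : language) (Phi : theory L) :=
  gen_eqMixin (Mod Phi).
HB.instance Definition _ (L : language) (Phi : theory L) :=
  gen_choiceMixin (Mod Phi).
HB.instance Definition _ (L : language) (Phi : theory L) :=
  @isSubBaseTopological.Build (Mod Phi) (set (Mod Phi))
    (@logic_subbase L Phi) id.

Definition borel_set (X : topologicalType) : set (set X) := <<s @open X >>.

Definition borel_map (X Y : topologicalType) (f : X -> Y) : Prop :=
  forall B : set Y, borel_set B -> borel_set (f @^-1` B).

Definition borel_reducible (L L' : language) (Phi : theory L)
    (Psi : theory L') : Prop :=
  exists f : Mod Phi -> Mod Psi,
    borel_map f /\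
    forall M N : Mod Phi, isomorphic M N <-> isomorphic (f M) (f N).

(** * Relational languages and the jump *)

Record rel_language := RelLanguage {
  rl_sym : countType;
  rl_arity : rl_sym -> nat }.
Arguments rl_arity {r} _.

(* The one-sorted languages are those whose only sort is [tt]. *)
Definition language_of_rel (L : rel_language) : language :=
  @Language unit void (fun _ => 0) (fun _ _ => tt) (fun _ => tt)
    (rl_sym L) (@rl_arity L) (fun _ _ => tt).
Coercion language_of_rel : rel_language >-> language.

(* In a one-sorted language every variable is a term of every sort; the cast
   is the identity as soon as [G v] and [s] reduce. *)
Definition unit_eq (x y : unit) : x = y :=
  match x, y with tt, tt => erefl end.

Definition var (L : rel_language) V (G : V -> lsort L) (v : V) (s : lsort L) :
    term G s :=
  ecast s' (term G s') (unit_eq (G v) s) (Var v).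

Definition single_sort (L : rel_language) n (_ : 'I_n) : lsort L := tt.

Definition jump_language (L : rel_language) : rel_language :=
  @RelLanguage (option (rl_sym L))
    (fun R => if R is Some R' then rl_arity R' else 2).

Section Jump.
Variable L : rel_language.
Let JL := jump_language L.

Definition Erel V (G : V -> lsort JL) (x y : V) : formula G :=
  @Rel JL V G None (fun i => var G (if i == ord0 then x else y) tt).

Definition jump_term V (G : V -> lsort L) W (D : W -> lsort JL) (rho : V -> W)
    s (t : term G s) : term D s :=
  match t in term _ s return term D s with
  | Var v => var D (rho v) (G v)
  | App f _ => match f with end
  end.

(* [relativize p D rho x] says that [p] holds in the E-class of [x]. *)
Fixpoint relativize V (G : V -> lsort L) (p : formula G) :
    forall W (D : W -> lsort JL), (V -> W) -> W -> formula D :=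
  match p with
  | Eq s t u => fun W D rho x => Eq (jump_term D rho t) (jump_term D rho u)
  | Rel R ts => fun W D rho x =>
      @Rel JL W D (Some R) (fun i => jump_term D rho (ts i))
  | Bot => fun W D rho x => Bot
  | And p q => fun W D rho x =>
      And (relativize p D rho x) (relativize q D rho x)
  | Or p q => fun W D rho x =>
      Or (relativize p D rho x) (relativize q D rho x)
  | Imp p q => fun W D rho x =>
      Imp (relativize p D rho x) (relativize q D rho x)
  | All n g p => fun W D rho x =>
      All (g : 'I_n -> lsort JL)
        (Imp (Conj (fun i => Erel (ctx_cat D g) (inl x) (inr i)))
             (relativize p (ctx_cat D g)
                (fun v => match v with inl w => inl (rho w) | inr i => inr i end)
                (inl x)))
  | Ex n g p => fun W D rho x =>
      Ex (g : 'I_n -> lsort JL)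
        (And (Conj (fun i => Erel (ctx_cat D g) (inl x) (inr i)))
             (relativize p (ctx_cat D g)
                (fun v => match v with inl w => inl (rho w) | inr i => inr i end)
                (inl x)))
  end.

(* the k-th variable of a block of length n *)
Local Notation "''v_' ( k , n )" := (inr (@Ordinal n k isT)) (at level 8).

Definition E_refl : sentence JL :=
  All (@single_sort JL 1) (Erel _ 'v_(0, 1) 'v_(0, 1)).

Definition E_sym : sentence JL :=
  All (@single_sort JL 2)
    (Imp (Erel _ 'v_(0, 2) 'v_(1, 2)) (Erel _ 'v_(1, 2) 'v_(0, 2))).

Definition E_trans : sentence JL :=
  All (@single_sort JL 3)
    (Imp (And (Erel _ 'v_(0, 3) 'v_(1, 3)) (Erel _ 'v_(1, 3) 'v_(2, 3)))
         (Erel _ 'v_(0, 3) 'v_(2, 3))).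

Definition E_classes (n : nat) : sentence JL :=
  Ex (@single_sort JL n)
    (Conj (fun i : 'I_n => Conj (fun j : 'I_n =>
       if i == j then Imp Bot Bot else Not (Erel _ (inr i) (inr j))))).

Definition class_models (p : sentence L) : sentence JL :=
  All (@single_sort JL 1)
    (relativize p _ (fun v : void => match v with end) 'v_(0, 1)).

Definition rel_within_class (R : rl_sym L) : sentence JL :=
  All (@single_sort JL (rl_arity R))
    (Imp (Not (Ex (@single_sort JL 1)
            (Conj (fun i => Erel _ 'v_(0, 1) (inl (inr i))))))
         (Not (@Rel JL _ _ (Some R) (fun i => var _ (inr i) tt)))).

Inductive jump (Phi : theory L) : theory JL :=
| jump_refl : jump Phi E_refl
| jump_sym : jump Phi E_sym
| jump_trans : jump Phi E_trans
| jump_classes n : jump Phi (E_classes n)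
| jump_models p : Phi p -> jump Phi (class_models p)
| jump_within R : jump Phi (rel_within_class R).

End Jump.

(** * The theories T_0, T_1 and T_2 *)

Definition succ_language : rel_language := @RelLanguage unit (fun _ => 2).

Definition int_succ : structure succ_language :=
  @Structure succ_language (fun _ => int)
    (@Interpretation succ_language (fun _ => int)
       (fun f => match f with end)
       (fun _ (a : 'I_2 -> int) => a ord_max = (a ord0 + 1)%R)).

Definition T0 : theory succ_language := complete_theory int_succ.
Definition T1 : theory (jump_language succ_language) := jump T0.
Definition T2 : theory (jump_language (jump_language succ_language)) := jump T1.

(** * Koerwien's theory *)

Inductive Ksort := KU | KV of nat | KC of nat.

(* [Kpi i j] is the projection usually written pi_i^j. *)
Inductive Kfun := KS of nat | Kpi (i : nat) (j : 'I_i.+2).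

Definition Ksort_code (s : Ksort) : option (nat + nat) :=
  match s with KU => None | KV i => Some (inl i) | KC i => Some (inr i) end.
Definition Ksort_decode (c : option (nat + nat)) : Ksort :=
  match c with
  | None => KU | Some (inl i) => KV i | Some (inr i) => KC i
  end.
Lemma Ksort_codeK : cancel Ksort_code Ksort_decode. Proof. by case. Qed.
HB.instance Definition _ := Countable.copy Ksort (can_type Ksort_codeK).

Definition Kfun_code (f : Kfun) : nat + {i : nat & 'I_i.+2} :=
  match f with KS i => inl i | @Kpi i j => inr (existT _ i j) end.
Definition Kfun_decode (c : nat + {i : nat & 'I_i.+2}) : Kfun :=
  match c with inl i => KS i | inr (existT i j) => @Kpi i j end.
Lemma Kfun_codeK : cancel Kfun_code Kfun_decode. Proof. by case. Qed.
HB.instance Definition _ := Countable.copy Kfun (can_type Kfun_codeK).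

Definition Kpi_cod (i : nat) (j : 'I_i.+2) : Ksort :=
  if (j <= i)%N then KC j else KU.

Definition K_language : language :=
  @Language Ksort Kfun (fun _ => 1)
    (fun f _ => match f with KS i => KV i | @Kpi i _ => KV i end)
    (fun f => match f with KS i => KV i | @Kpi i j => Kpi_cod j end)
    void (fun _ => 0) (fun R _ => match R with end).

Section Koerwien.

(* the k-th variable of a block of length n *)
Local Notation "''v_' ( k , n )" := (inr (@Ordinal n k isT)) (at level 8).

Let KL := K_language.

Definition block (n : nat) (s : Ksort) (_ : 'I_n) : lsort KL := s.

Definition KEq V (G : V -> lsort KL) (s : Ksort) (t u : @term KL V G s) :
    formula G := @Eq KL V G s t u.
Arguments KEq {V G} s & t u.

Definition Sapp V (G : V -> lsort KL) i (t : @term KL V G (KV i)) :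
    @term KL V G (KV i) :=
  @App KL V G (KS i) (fun _ => t).

Definition piapp V (G : V -> lsort KL) i (j : 'I_i.+2) (t : @term KL V G (KV i)) :
    @term KL V G (Kpi_cod j) :=
  @App KL V G (Kpi j) (fun _ => t).

Definition K_infinite (s : Ksort) (n : nat) : sentence KL :=
  Ex (@block n s)
    (Conj (fun i : 'I_n => Conj (fun j : 'I_n =>
       if i == j then Imp Bot Bot else Not (KEq s (Var (inr i)) (Var (inr j)))))).

Definition K_size2 (i : nat) : sentence KL :=
  Ex (@block 2 (KC i))
    (And (Not (KEq (KC i) (Var 'v_(0, 2)) (Var 'v_(1, 2))))
       (All (@block 1 (KC i))
          (Or (KEq (KC i) (Var 'v_(0, 1)) (Var (inl 'v_(0, 2))))
              (KEq (KC i) (Var 'v_(0, 1)) (Var (inl 'v_(1, 2))))))).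

Definition K_fiber (i : nat) : sentence KL :=
  All (@Kpi_cod i : 'I_i.+2 -> lsort KL)
    (Ex (@block 1 (KV i))
       (Conj (fun j : 'I_i.+2 => Eq (piapp j (Var 'v_(0, 1))) (Var (inl (inr j)))))).

Definition K_S_inj (i : nat) : sentence KL :=
  All (@block 2 (KV i))
    (Imp (Eq (Sapp (i := i) (Var 'v_(0, 2))) (Sapp (i := i) (Var 'v_(1, 2))))
         (KEq (KV i) (Var 'v_(0, 2)) (Var 'v_(1, 2)))).

Definition K_S_surj (i : nat) : sentence KL :=
  All (@block 1 (KV i))
    (Ex (@block 1 (KV i)) (Eq (Sapp (i := i) (Var 'v_(0, 1))) (Var (inl 'v_(0, 1))))).

Definition K_S_acyclic (i n : nat) : sentence KL :=
  All (@block 1 (KV i))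
    (Not (Eq (iter n.+1 (@Sapp _ _ i) (Var 'v_(0, 1))) (Var 'v_(0, 1)))).

Definition K_S_fiber (i : nat) (j : 'I_i.+2) : sentence KL :=
  All (@block 1 (KV i))
    (Eq (piapp j (Sapp (i := i) (Var 'v_(0, 1)))) (piapp j (Var 'v_(0, 1)))).

(* Disjointness of the sorts and the domains and codomains of the functions are
   part of the multisorted language. *)
Inductive K : theory KL :=
| K_U_infinite n : K (K_infinite KU n)
| K_V_infinite i n : K (K_infinite (KV i) n)
| K_C_size2 i : K (K_size2 i)
| K_fiber_nonempty i : K (K_fiber i)
| K_S_injective i : K (K_S_inj i)
| K_S_surjective i : K (K_S_surj i)
| K_S_no_cycle i n : K (K_S_acyclic i n)
| K_pi_S i j : K (@K_S_fiber i j).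

End Koerwien.

(* Main.v *)
(** A model of [T2] is determined up to isomorphism by a countable family, with
    multiplicities, of invariants: one for each outer class [u], counting for
    each [i] in {1, 2, ..., infinity} the inner classes of [u] that consist of
    exactly [i] successor orbits.  A model of [K] is determined by the numbers
    d_i(c, u) in {1, 2, ..., infinity} of successor orbits in the fiber of
    [pi_i] over [(c, u)].  The reduction lets [u] range over the outer classes
    and makes d_i(c, u) independent of [c], equal to one plus the number of
    inner classes of [u] with [i] orbits ([i = 0] standing for infinity).  Since
    [c] plays no role, isomorphic images have the same invariants with the same
    multiplicities.  The image is realized as a Borel-varying subset of a fixed
    countable set of codes, which is then enumerated in increasing order. *)

From HB Require Import structures.
From mathcomp Require Import all_boot all_order all_algebra.
From mathcomp Require Import boolp classical_sets functions cardinality filter.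
From mathcomp Require Import topology measure.
From mathcomp Require Import zify.
Require Import Defs.

Set Implicit Arguments.
Unset Strict Implicit.
Unset Printing Implicit Defensive.

Local Open Scope classical_set_scope.

(** * Borel sets of the logic topology *)

Section BorelSets.
Variable X : topologicalType.
Implicit Types A B : X -> Prop.

(** An outer class may have no inner class with exactly [i] orbits, while every fiber of [pi_i] must
    be nonempty: this is the origin of the added orbit. It loses nothing, because [1 + a = 1 + b]
    forces [a = b] for finite and infinite numbers alike. An inner class has at least one orbit,
    which leaves the index 0 free for infinity. An isomorphism of models of K may exchange the two
    elements of any [C_j], so only data independent of [c] are safe from it. Multiplicities are
    never computed: the orbits of a fiber other than the added one are named by the inner classes
    themselves, and isomorphism becomes the existence of bijections between sets of names, which can
    be glued along fibrations. Choices would endanger Borelness: a class is therefore represented by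
    its least element, and the place of a code in the universe omega is the number of smaller codes
    present. The successor function of a model of [T2] is obtained by choice, but only its graph,
    which is part of the model, enters the construction. *)

Lemma borel_open A : open (A : set X) -> borel_set (A : set X).
Proof. exact: sub_sigma_algebra. Qed.

Lemma borel_not A : borel_set A -> borel_set (fun x => ~ A x).
Proof.
move=> /sigma_algebraCD; rewrite /borel_set; congr (smallest _ _ _).
by rewrite setTD.
Qed.

Lemma borel_exists (I : countType) (A : I -> X -> Prop) :
  (forall i, borel_set (A i)) -> borel_set (fun x => exists i, A i x).
Proof.
move=> bA.
pose B n : set X := if unpickle n is Some i then A i else set0.
have -> : (fun x => exists i, A i x) = \bigcup_n B n.
  apply/funext => x; apply/propext; split=> [[i Aix]|[n _]].
    by exists (pickle i); rewrite // /B pickleK.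
  by rewrite /B; case: unpickle => // i Aix; exists i.
apply: sigma_algebra_bigcup => n; rewrite /B.
case: unpickle => [i|]; [exact: bA|exact: sigma_algebra0].
Qed.

Lemma borel_forall (I : countType) (A : I -> X -> Prop) :
  (forall i, borel_set (A i)) -> borel_set (fun x => forall i, A i x).
Proof.
move=> bA.
have -> : (fun x => forall i, A i x) = (fun x => ~ exists i, ~ A i x).
  apply/funext => x; apply/propext; split=> [AA [i]|nA i]; first exact.
  by apply: contrapT => nAi; apply: nA; exists i.
by apply: borel_not; apply: borel_exists => i; exact: borel_not.
Qed.

Lemma borel_or A B : borel_set A -> borel_set B ->
  borel_set (fun x => A x \/ B x).
Proof.
move=> bA bB.
have -> : (fun x => A x \/ B x) = (fun x => exists b : bool, if b then A x else B x).
  apply/funext => x; apply/propext; split=> [[Ax|Bx]|[[] ?]].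
  - by exists true.
  - by exists false.
  - by left.
  - by right.
by apply: borel_exists => -[].
Qed.

Lemma borel_and A B : borel_set A -> borel_set B ->
  borel_set (fun x => A x /\ B x).
Proof.
move=> bA bB.
have -> : (fun x => A x /\ B x) = (fun x => ~ (~ A x \/ ~ B x)).
  by apply/funext => x; rewrite not_orE !notK.
by apply: borel_not; apply: borel_or; exact: borel_not.
Qed.

Lemma borel_imp A B : borel_set A -> borel_set B ->
  borel_set (fun x => A x -> B x).
Proof.
move=> bA bB.
have -> : (fun x => A x -> B x) = (fun x => ~ A x \/ B x).
  by apply/funext => x; rewrite implyE.
by apply: borel_or => //; exact: borel_not.
Qed.

Lemma borel_iff A B : borel_set A -> borel_set B ->
  borel_set (fun x => A x <-> B x).
Proof. by move=> bA bB; apply: borel_and; apply: borel_imp. Qed.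

Lemma borel_const (P : Prop) : borel_set (fun _ : X => P).
Proof.
have b0 : borel_set (fun _ : X => False) by exact: sigma_algebra0.
have [p|np] := pselect P.
- have -> : (fun _ : X => P) = (fun _ => ~ False).
    by apply/funext => x; apply/propext; split=> // _ [].
  exact: borel_not.
- have -> // : (fun _ : X => P) = (fun _ => False).
  by apply/funext => x; apply/propext; split.
Qed.

(** Meant for families of sets, whose index type is not countable: an injection of [D] into the
    naturals regroups the union, and each natural number is reached from at most one index. *)
Lemma borel_exists_countable (I : Type) (D : set I) (A : I -> X -> Prop) :
  countable D -> (forall i, D i -> borel_set (A i)) ->
  borel_set (fun x => exists2 i, D i & A i x).
Proof.
move=> /pcard_leP[g] bA.
have -> : (fun x => exists2 i, D i & A i x) =
    (fun x => exists n, exists2 i, D i /\ g i = n & A i x).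
  apply/funext => x; apply/propext; split=> [[i Di Aix]|[n [i [Di _] Aix]]].
    by exists (g i); exists i.
  by exists i.
apply: borel_exists => n.
have [[i [Di gi]]|nD] := pselect (exists i, D i /\ g i = n).
  suff -> : (fun x => exists2 i, D i /\ g i = n & A i x) = A i by exact: bA.
  apply/funext => x; apply/propext; split=> [[j [Dj gj] Ajx]|Aix].
    suff <- : j = i by [].
    exact: (inj (mem_set Dj) (mem_set Di) (etrans gj (esym gi))).
  by exists i.
suff -> : (fun x => exists2 i, D i /\ g i = n & A i x) = (fun=> False).
  exact: borel_const.
by apply/funext => x; apply/propext; split=> // -[i Di _]; apply: nD; exists i.
Qed.

Lemma borel_forall_countable (I : Type) (D : set I) (A : I -> X -> Prop) :
  countable D -> (forall i, D i -> borel_set (A i)) ->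
  borel_set (fun x => forall i, D i -> A i x).
Proof.
move=> cD bA.
have -> : (fun x => forall i, D i -> A i x) =
    (fun x => ~ exists2 i, D i & ~ A i x).
  apply/funext => x; apply/propext; split=> [AA [i Di]|nA i Di].
    by apply; exact: AA.
  by apply: contrapT => nAi; apply: nA; exists i.
apply: borel_not; apply: borel_exists_countable => // i Di.
by apply: borel_not; exact: bA.
Qed.

End BorelSets.

Section LogicTopology.
Variables (L : language) (Phi : theory L).

Lemma borel_fact (F : atomic_fact L) :
  borel_set (fun M : Mod Phi => fact_holds M F).
Proof.
apply: borel_open.
pose A : set (Mod Phi) := [set M | fact_holds M F].
have sA : logic_subbase A by exists F; left.
exists [set A]; last by rewrite bigcup_set1.
by move=> _ ->; exact: finI_from1.
Qed.

(** The arguments of an atomic fact form a plain function, a type without countable structure;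
    storing them as finite functions gives a countable type. *)
Let facts := ({f : fsym L & {ffun 'I_(farity f) -> nat}} * nat
  + {R : rsym L & {ffun 'I_(rarity R) -> nat}} + nat * lsort L)%type.

Let fact_code (F : atomic_fact L) : facts :=
  match F with
  | SortFact n s => inr (n, s)
  | FunFact f a b => inl (inl (existT _ f (finfun a), b))
  | RelFact R a => inl (inr (existT _ R (finfun a)))
  end.

Let fact_decode (c : facts) : atomic_fact L :=
  match c with
  | inr (n, s) => SortFact n s
  | inl (inl (existT f a, b)) => FunFact a b
  | inl (inr (existT R a)) => RelFact a
  end.

Let fact_codeK : cancel fact_code fact_decode.
Proof.
by case=> [n s|f a b|R a] //=; [congr FunFact|congr RelFact];
  apply/funext => i; rewrite ffunE.
Qed.

Lemma countable_subbase : countable (@logic_subbase L Phi).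
Proof.
pose g (c : facts * bool) : set (Mod Phi) :=
  if c.2 then [set M | fact_holds M (fact_decode c.1)]
  else [set M | ~ fact_holds M (fact_decode c.1)].
apply: (@sub_countable _ _ _ (range g)).
  apply: subset_card_le => A [F [->|->]].
  - by exists (fact_code F, true) => //; rewrite /g /= fact_codeK.
  - by exists (fact_code F, false) => //; rewrite /g /= fact_codeK.
by apply: (sub_countable (card_image_le _ _)); exact: countableP.
Qed.

End LogicTopology.

(** The sets with Borel preimage form a sigma-algebra, so open sets suffice. An open set is a union
    of finite intersections of subbasic sets, and this union is countable because there are only
    countably many atomic facts. *)
Lemma borel_map_facts (X : topologicalType) (L : language) (Phi : theory L)
    (f : X -> Mod Phi) :
  (forall F, borel_set (fun x => fact_holds (f x) F)) -> borel_map f.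
Proof.
move=> bf.
pose G : set (set (Mod Phi)) := [set B | borel_set (f @^-1` B)].
suff openG : open `<=` G.
  apply: smallest_sub => //; split.
  - exact: (borel_const False).
  - by move=> A GA; rewrite /G /= setTD; exact: borel_not.
  - move=> A GA; rewrite /G /= preimage_bigcup; exact: sigma_algebra_bigcup.
have subG A : logic_subbase A -> G A.
  by move=> [F [->|->]]; [exact: bf|apply: borel_not; exact: bf].
move=> _ [D sD <-]; rewrite /G /=.
rewrite preimage_bigcup; apply: borel_exists_countable => [|A /sD[S sS <-]].
  apply: (@sub_countable _ _ _ _ (subset_card_le sD)).
  exact/finI_from_countable/countable_subbase.
rewrite preimage_bigcap; apply: borel_forall_countable => [|B /sS].
  exact/finite_set_countable/finite_fset.
by rewrite inE => /subG.
Qed.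

(** * Models of a jump *)

Lemma sat_Conj (L : language) (M : structure L) V (G : V -> lsort L) n
    (p : 'I_n -> formula G) (r : forall v, M (G v)) :
  sat (Conj p) r <-> forall i, sat (p i) r.
Proof.
have -> : (forall i, sat (p i) r) <-> (forall i, i \in enum 'I_n -> sat (p i) r).
  by split=> H i // ; apply: H; rewrite mem_enum.
rewrite /Conj; elim: (enum 'I_n) => [|j s IH] /=; first by split.
rewrite IH; split=> [[pj ps] i|ps].
  by rewrite inE => /predU1P[->|/ps].
by split=> [|i si]; apply: ps; rewrite inE ?eqxx // si orbT.
Qed.

Lemma sat_All (L : language) (M : structure L) V (G : V -> lsort L) n
    (g : 'I_n -> lsort L) (p : formula (ctx_cat G g)) (r : forall v, M (G v)) :
  sat (All g p) r = (forall a : forall i, M (g i), sat p (val_cat r a)).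
Proof. by []. Qed.

Lemma sat_Imp (L : language) (M : structure L) V (G : V -> lsort L)
    (p q : formula G) (r : forall v, M (G v)) :
  sat (Imp p q) r = (sat p r -> sat q r).
Proof. by []. Qed.

Lemma sat_And (L : language) (M : structure L) V (G : V -> lsort L)
    (p q : formula G) (r : forall v, M (G v)) :
  sat (And p q) r = (sat p r /\ sat q r).
Proof. by []. Qed.

Section JumpSemantics.
Variables (L : rel_language) (M : structure (jump_language L)).

(** A sort of a one-sorted language is a term of type [unit] that need not reduce to [tt]; this
    transport and the next one move elements to the fixed carrier at [tt] and back. *)
Definition to_tt (X : unit -> Type) (s : unit) : X s -> X tt :=
  match s with tt => id end.

Definition of_tt (X : unit -> Type) (s : unit) : X tt -> X s :=
  match s with tt => id end.

Lemma of_ttK (X : unit -> Type) s : cancel (@of_tt X s) (@to_tt X s).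
Proof. by case: s. Qed.

Lemma to_ttK (X : unit -> Type) s : cancel (@to_tt X s) (@of_tt X s).
Proof. by case: s. Qed.

Lemma term_eval_var (L' : rel_language) (N : structure L') V
    (G : V -> lsort L') (r : forall v, N (G v)) v s :
  to_tt (term_eval r (var G v s)) = to_tt (r v).
Proof. by rewrite /var; case: _ / (unit_eq (G v) s). Qed.

Definition class_rel (x y : M tt) : Prop :=
  @rint _ M (interp M) None (fun i : 'I_2 => if i == ord0 then x else y).

Lemma sat_Erel V (G : V -> lsort (jump_language L)) x y (r : forall v, M (G v)) :
  sat (Erel G x y) r <-> class_rel (to_tt (r x)) (to_tt (r y)).
Proof.
rewrite /class_rel /=.
suff -> : (fun i : 'I_2 => term_eval r (var G (if i == ord0 then x else y) tt)) =
    (fun i : 'I_2 => if i == ord0 then to_tt (r x) else to_tt (r y)) by [].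
apply/funext => i.
by rewrite -[LHS]/(@to_tt M tt _) term_eval_var; case: (i == ord0).
Qed.

Definition class_struct (x : M tt) : structure L :=
  @Structure L (fun _ => {y : M tt | class_rel x y})
    (@Interpretation L (fun _ => {y : M tt | class_rel x y})
       (fun f => match f with end)
       (fun R a => @rint _ M (interp M) (Some R) (fun i => sval (a i)))).

(** Induction on the formula, with all assignments general: a quantifier guarded by [Erel] ranges
    over the tuples from the class of [x], and these are the tuples of [class_struct]. *)
Lemma sat_relativize V (G : V -> lsort L) (p : formula G) W
    (D : W -> lsort (jump_language L)) (rho : V -> W) x
    (r : forall w, M (D w)) (q : forall v, class_struct (to_tt (r x)) (G v)) :
  (forall v, sval (q v) = to_tt (r (rho v))) ->
  sat (relativize p D rho x) r <-> sat p q.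
Proof.
have evalE V1 (G1 : V1 -> lsort L) W1 (D1 : W1 -> lsort (jump_language L))
    (rho1 : V1 -> W1) x1 (r1 : forall w, M (D1 w))
    (q1 : forall v, class_struct x1 (G1 v)) s (t : term G1 s) :
    (forall v, sval (q1 v) = to_tt (r1 (rho1 v))) ->
    to_tt (term_eval r1 (jump_term D1 rho1 t)) = sval (term_eval q1 t).
  by case: t => [v|[]] qr /=; rewrite term_eval_var -qr.
elim: p W D rho x r q =>
    [{}V {}G s t u|{}V {}G R ts|//|{}V {}G p IHp p' IHp'|{}V {}G p IHp p' IHp'
    |{}V {}G p IHp p' IHp'|{}V {}G n g p IHp|{}V {}G n g p IHp] W D rho x r q qr /=.
- split=> [tu|tu].
    apply: eq_sig_hprop => [? ? ?|]; first exact: Prop_irrelevance.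
    by rewrite -!(evalE _ _ _ _ rho _ r) // tu.
  apply: (can_inj (@to_ttK M s)).
  by rewrite (evalE _ _ _ _ rho _ r q _ t) // (evalE _ _ _ _ rho _ r q _ u) // tu.
- suff -> : (fun i => term_eval r (jump_term D rho (ts i))) =
    (fun i => sval (term_eval q (ts i))) by [].
  by apply: functional_extensionality_dep => i; rewrite -(evalE _ _ _ _ rho _ r).
- by rewrite (IHp _ _ _ _ r q) // (IHp' _ _ _ _ r q).
- by rewrite (IHp _ _ _ _ r q) // (IHp' _ _ _ _ r q).
- by rewrite (IHp _ _ _ _ r q) // (IHp' _ _ _ _ r q).
- split=> [H a|H a].
    pose b i : M (g i) := @of_tt M (g i) (sval (a i)).
    have /H : sat (Conj (fun i => Erel (ctx_cat D g) (inl x) (inr i)))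
        (val_cat (X := M) r b).
      by apply/sat_Conj => i; apply/sat_Erel; rewrite /= of_ttK; exact: svalP.
    rewrite (IHp _ _ _ (inl x) (val_cat (X := M) r b)
      (@val_cat _ _ (class_struct (to_tt (r x))) _ _ g q a)) //.
    by case=> [v|i] /=; rewrite ?of_ttK.
  move=> /sat_Conj H'.
  have ab i : class_rel (to_tt (r x)) (to_tt (a i)) by have /sat_Erel := H' i.
  pose b i : class_struct (to_tt (r x)) (g i) := exist _ _ (ab i).
  rewrite (IHp _ _ _ (inl x) (val_cat (X := M) r a)
    (@val_cat _ _ (class_struct (to_tt (r x))) _ _ g q b)) //.
  by case.
- split=> [[a [/sat_Conj H']]|[a H]].
    have ab i : class_rel (to_tt (r x)) (to_tt (a i)) by have /sat_Erel := H' i.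
    pose b i : class_struct (to_tt (r x)) (g i) := exist _ _ (ab i).
    rewrite (IHp _ _ _ (inl x) (val_cat (X := M) r a)
    (@val_cat _ _ (class_struct (to_tt (r x))) _ _ g q b)) //.
      by exists b.
    by case.
  pose b i : M (g i) := @of_tt M (g i) (sval (a i)).
  exists b; split.
    by apply/sat_Conj => i; apply/sat_Erel; rewrite /= of_ttK; exact: svalP.
  rewrite (IHp _ _ _ (inl x) (val_cat (X := M) r b)
    (@val_cat _ _ (class_struct (to_tt (r x))) _ _ g q a)) //.
  by case=> [v|i] /=; rewrite ?of_ttK.
Qed.

Variable Phi : theory L.
Hypothesis modM : models M (jump Phi).

Lemma class_rel_refl x : class_rel x x.
Proof.
have := modM (jump_refl Phi).
by rewrite /holds /E_refl sat_All => /(_ (fun=> x))/sat_Erel.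
Qed.

Lemma class_rel_sym x y : class_rel x y -> class_rel y x.
Proof.
have := modM (jump_sym Phi); rewrite /holds /E_sym.
rewrite sat_All => /(_ (fun i => if i == ord0 then x else y)).
by rewrite sat_Imp !sat_Erel.
Qed.

Lemma class_rel_trans y x z : class_rel x y -> class_rel y z -> class_rel x z.
Proof.
move=> xy yz; have := modM (jump_trans Phi); rewrite /holds /E_trans.
rewrite sat_All => /(_ (fun i : 'I_3 => nth x [:: x; y; z] i)).
by rewrite sat_Imp sat_And !sat_Erel; apply.
Qed.

Lemma class_rel_infinite n : exists a : 'I_n -> M tt,
  forall i j, i != j -> ~ class_rel (a i) (a j).
Proof.
have [a /sat_Conj H] := modM (jump_classes Phi n).
exists a => i j ij; have /sat_Conj/(_ j) := H i.
by rewrite (negPf ij) => nE aij; apply: nE; exact/sat_Erel.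
Qed.

Lemma class_struct_models x : models (class_struct x) Phi.
Proof.
move=> p Phip; have := modM (jump_models Phip); rewrite /holds /class_models.
rewrite sat_All => /(_ (fun=> x)).
by apply: iffLR; apply: sat_relativize => -[].
Qed.

Lemma rint_within_class R (a : 'I_(rl_arity R) -> M tt) :
  @rint _ M (interp M) (Some R) a -> exists y, forall i, class_rel y (a i).
Proof.
move=> Ra; apply: contrapT => nE; have := modM (jump_within Phi R).
rewrite /holds /rel_within_class sat_All => /(_ a) H.
apply: H => [[y /sat_Conj yE]|].
  by apply: nE; exists (y (@Ordinal 1 0 isT)) => i; have /sat_Erel := yE i.
have Rb (b : 'I_(rl_arity R) -> M tt) :
    b =1 a -> @rint _ M (interp M) (Some R) b by move=> /funext->.
exact: Rb.
Qed.

End JumpSemantics.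

(** * First-order consequences of the theory of the integers with successor *)

Section SuccessorTheory.

Definition pairf (T : Type) (x y : T) : 'I_2 -> T :=
  fun i => if i == ord0 then x else y.

Lemma pairf_map (T U : Type) (f : T -> U) x y :
  (fun i => f (pairf x y i)) = pairf (f x) (f y).
Proof. by apply/funext => i; rewrite /pairf; case: ifP. Qed.

Lemma pairf_eta (T : Type) (a : 'I_2 -> T) : a = pairf (a ord0) (a ord_max).
Proof.
apply/funext => i; rewrite /pairf; case: eqP => [->//|i0]; congr a.
by case: i i0 => [[|[|i]] ilt] i0; apply: val_inj => //; case: i0; exact: val_inj.
Qed.

Definition succ_rel (N : structure succ_language) (x y : N tt) : Prop :=
  @rint _ N (interp N) tt (pairf x y).

Let Srel V (G : V -> lsort succ_language) (x y : V) : formula G :=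
  @Rel succ_language V G tt (fun i => var G (pairf x y i) tt).

Let Veq V (G : V -> lsort succ_language) (x y : V) : formula G :=
  @Eq succ_language V G tt (var G x tt) (var G y tt).

Let sat_Srel (N : structure succ_language) V (G : V -> lsort succ_language) x y
    (r : forall v, N (G v)) :
  sat (Srel G x y) r <-> succ_rel (to_tt (r x)) (to_tt (r y)).
Proof.
rewrite /succ_rel /= -(pairf_map (fun v => to_tt (r v))).
suff -> : (fun i => term_eval r (var G (pairf x y i) tt)) =
    (fun i => to_tt (r (pairf x y i))) by [].
by apply/funext => i; rewrite -[LHS]/(@to_tt N tt _) term_eval_var.
Qed.

Let sat_Veq (N : structure succ_language) V (G : V -> lsort succ_language) x y
    (r : forall v, N (G v)) :
  sat (Veq G x y) r <-> to_tt (r x) = to_tt (r y).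
Proof.
rewrite -(term_eval_var r x tt) -(term_eval_var r y tt) /=.
by split=> [->|].
Qed.

Let blk n := @single_sort succ_language n.

Local Notation "''v_' ( k , n )" := (inr (@Ordinal n k isT)) (at level 8).

Let s_total : sentence succ_language :=
  All (@blk 1) (Ex (@blk 1) (Srel _ (inl 'v_(0, 1)) 'v_(0, 1))).

Let s_onto : sentence succ_language :=
  All (@blk 1) (Ex (@blk 1) (Srel _ 'v_(0, 1) (inl 'v_(0, 1)))).

Let s_fun : sentence succ_language :=
  All (@blk 3) (Imp (Srel _ 'v_(0, 3) 'v_(1, 3))
    (Imp (Srel _ 'v_(0, 3) 'v_(2, 3)) (Veq _ 'v_(1, 3) 'v_(2, 3)))).

Let s_inj : sentence succ_language :=
  All (@blk 3) (Imp (Srel _ 'v_(0, 3) 'v_(1, 3))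
    (Imp (Srel _ 'v_(2, 3) 'v_(1, 3)) (Veq _ 'v_(0, 3) 'v_(2, 3)))).

(** A cycle of length [n.+1] is written with the cyclic successor [ordS] of indices; the case
    [n = 0] excludes fixed points. *)
Let s_acyclic n : sentence succ_language :=
  All (@blk n.+1) (Not (Conj (fun i => Srel _ (inr i) (inr (ordS i))))).

Let s_totalE (N : structure succ_language) :
  holds N s_total <-> forall x : N tt, exists y, succ_rel x y.
Proof.
rewrite /holds /s_total sat_All; split=> [H x|H a].
  by have [a /sat_Srel] := H (fun=> x); exists (a (@Ordinal 1 0 isT)).
have [y xy] := H (a (@Ordinal 1 0 isT)).
by exists (fun=> y); apply/sat_Srel.
Qed.

Let s_ontoE (N : structure succ_language) :
  holds N s_onto <-> forall y : N tt, exists x, succ_rel x y.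
Proof.
rewrite /holds /s_onto sat_All; split=> [H x|H a].
  by have [a /sat_Srel] := H (fun=> x); exists (a (@Ordinal 1 0 isT)).
have [y xy] := H (a (@Ordinal 1 0 isT)).
by exists (fun=> y); apply/sat_Srel.
Qed.

Let s_funE (N : structure succ_language) :
  holds N s_fun <->
  forall x y z : N tt, succ_rel x y -> succ_rel x z -> y = z.
Proof.
rewrite /holds /s_fun sat_All; split=> [H x y z|H a].
  have := H (fun i : 'I_3 => nth x [:: x; y; z] i).
  by rewrite !sat_Imp !sat_Srel sat_Veq.
by rewrite !sat_Imp !sat_Srel sat_Veq; exact: H.
Qed.

Let s_injE (N : structure succ_language) :
  holds N s_inj <->
  forall x y z : N tt, succ_rel x y -> succ_rel z y -> x = z.
Proof.
rewrite /holds /s_inj sat_All; split=> [H x y z|H a].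
  have := H (fun i : 'I_3 => nth x [:: x; y; z] i).
  by rewrite !sat_Imp !sat_Srel sat_Veq.
by rewrite !sat_Imp !sat_Srel sat_Veq; exact: H.
Qed.

Let s_acyclicE (N : structure succ_language) n :
  holds N (s_acyclic n) <->
  forall a : 'I_n.+1 -> N tt, ~ forall i, succ_rel (a i) (a (ordS i)).
Proof.
rewrite /holds /s_acyclic sat_All; split=> [H a aS|H a /sat_Conj aS].
  by apply: (H a); apply/sat_Conj => i; apply/sat_Srel; exact: aS.
by apply: (H a) => i; have /sat_Srel := aS i.
Qed.

Variable N : structure succ_language.
Hypothesis modN : models N T0.

(** Membership in [T0] is truth in the integers, so the chain of views replaces [N] by the integers,
    where the property is checked directly. The next lemmas follow the same pattern. *)
Lemma succ_rel_total (x : N tt) : exists y, succ_rel x y.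
Proof.
move: x; apply/s_totalE/modN/s_totalE => x.
by exists (x + 1)%R.
Qed.

Lemma succ_rel_onto (y : N tt) : exists x, succ_rel x y.
Proof.
move: y; apply/s_ontoE/modN/s_ontoE => y.
by exists (y - 1)%R; rewrite /succ_rel /= /pairf /= GRing.subrK.
Qed.

Lemma succ_rel_fun (x y z : N tt) : succ_rel x y -> succ_rel x z -> y = z.
Proof.
move: x y z; apply/s_funE/modN/s_funE => x y z.
by rewrite /succ_rel /= /pairf /= => -> ->.
Qed.

Lemma succ_rel_inj (x y z : N tt) : succ_rel x y -> succ_rel z y -> x = z.
Proof.
move: x y z; apply/s_injE/modN/s_injE => x y z.
by rewrite /succ_rel /= /pairf /= => -> /GRing.addIr.
Qed.

(** Around a cycle of integers the sum of the [a i] would equal itself plus [n.+1]. Excluding cycles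
    of one given length is first-order, so the argument transfers to [N]. *)
Lemma succ_rel_acyclic n (a : 'I_n.+1 -> N tt) :
  ~ forall i, succ_rel (a i) (a (ordS i)).
Proof.
move: a; apply/s_acyclicE/modN/s_acyclicE => a.
rewrite /succ_rel /= /pairf /= => aS.
have : (\sum_i a (ordS i) = \sum_i (a i + 1))%R by apply: eq_bigr => i _.
have <- : (\sum_i a i = \sum_i a (ordS i))%R.
  by rewrite [LHS](reindex_inj (@ordS_inj _)).
rewrite big_split /= -[LHS]GRing.addr0 => /GRing.addrI.
rewrite GRing.sumr_const card_ord; lia.
Qed.

End SuccessorTheory.

(** * Models of [T2] as nested equivalence relations with a successor *)

Definition equivalence (T : Type) (R : T -> T -> Prop) : Prop :=
  [/\ forall x, R x x, forall x y, R x y -> R y x &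
      forall y x z, R x y -> R y z -> R x z].

(** The content of a model of [T2] on omega from which the invariants are read; [outer_infinite]
    will make the sort [U] infinite. *)
Record nested_successor (E F : nat -> nat -> Prop) (s : nat -> nat) : Prop := {
  outer_equiv : equivalence E;
  inner_equiv : equivalence F;
  inner_outer : forall x y, F x y -> E x y;
  inner_succ : forall x, F x (s x);
  succ_bijective : bijective s;
  succ_acyclic : forall n x, iter n.+1 s x <> x;
  outer_infinite : forall n, exists a : 'I_n -> nat,
    forall i j, i != j -> ~ E (a i) (a j) }.

Section T2Semantics.

Let JL := jump_language succ_language.
Let JJL := jump_language JL.

Section Structure.
Variable M : structure JJL.
Hypothesis modM : models M T2.

Let E (x y : M tt) := @rint _ M (interp M) None (pairf x y).
Let F (x y : M tt) := @rint _ M (interp M) (Some None) (pairf x y).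
Let S (x y : M tt) := @rint _ M (interp M) (Some (Some tt)) (pairf x y).

Let E_equiv : equivalence E.
Proof.
split; [exact: class_rel_refl modM|exact: class_rel_sym modM|].
exact: class_rel_trans modM.
Qed.

Let outer x : structure JL := @class_struct JL M x.
Let modO x : models (outer x) T1 := class_struct_models modM x.

Let FE (x y : M tt) : F x y -> E x y.
Proof.
case: E_equiv => _ sE tE /(rint_within_class modM)[w Ew].
by apply: (tE w); [apply: sE; exact: (Ew ord0)|exact: (Ew ord_max)].
Qed.

Let class_relE x (y z : outer x tt) : class_rel y z <-> F (sval y) (sval z).
Proof. by rewrite /F -(pairf_map sval). Qed.

(** Each outer class is a model of [T1], which gives the three laws inside it; by [FE], points
    related by [F] lie in a common outer class. *)
Let F_equiv : equivalence F.
Proof.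
case: E_equiv => rE sE tE; split=> [x|x y xy|y x z xy yz].
- pose x' : outer x tt := exist _ x (rE x).
  exact: (iffLR (class_relE x' x') (class_rel_refl (modO x) x')).
- pose x' : outer x tt := exist _ x (rE x).
  pose y' : outer x tt := exist _ y (FE xy).
  apply: (iffLR (class_relE y' x')); apply: (class_rel_sym (modO x)).
  exact: (iffRL (class_relE x' y')).
- pose x' : outer x tt := exist _ x (rE x).
  pose y' : outer x tt := exist _ y (FE xy).
  pose z' : outer x tt := exist _ z (tE _ _ _ (FE xy) (FE yz)).
  apply: (iffLR (class_relE x' z')); apply: (class_rel_trans (modO x) (y := y')).
    exact: (iffRL (class_relE x' y')).
  exact: (iffRL (class_relE y' z')).
Qed.

(** The locality axiom is used at both levels: [S] cannot leave an outer class, and inside the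
    structure on that class it cannot leave an inner class. *)
Let SF (x y : M tt) : S x y -> F x y.
Proof.
move=> Sxy.
have [_ sF tF] := F_equiv.
have [w Ew] := rint_within_class modM Sxy.
pose x' : outer w tt := exist _ x (Ew ord0).
pose y' : outer w tt := exist _ y (Ew ord_max).
have [|v Fv] := @rint_within_class _ _ _ (modO w) tt (pairf x' y').
  by rewrite /= (pairf_map sval).
apply: (tF (sval v)).
  by apply: sF; exact: (iffLR (class_relE v x') (Fv ord0)).
exact: (iffLR (class_relE v y') (Fv ord_max)).
Qed.

Let refl_elt (x : M tt) : outer x tt :=
  exist _ x (let: And3 rE _ _ := E_equiv in rE x).
Let inner x : structure succ_language := @class_struct succ_language (outer x) (refl_elt x).
Let modI x : models (inner x) T0 := class_struct_models (modO x) (refl_elt x).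

Let inner_elt x y (Fxy : F x y) : inner x tt :=
  exist _ (exist _ y (FE Fxy) : outer x tt)
    (iffRL (class_relE (refl_elt x) (exist _ y (FE Fxy))) Fxy).

Let inner_succE x (y z : inner x tt) :
  succ_rel y z <-> S (sval (sval y)) (sval (sval z)).
Proof. by rewrite /S -(pairf_map (fun y : inner x tt => sval (sval y))). Qed.

Let S_total (x : M tt) : exists y, S x y.
Proof.
have [rF _ _] := F_equiv.
have [y /inner_succE xy] := succ_rel_total (modI x) (inner_elt (rF x)).
by exists (sval (sval y)).
Qed.

Let S_onto (x : M tt) : exists y, S y x.
Proof.
have [rF _ _] := F_equiv.
have [y /inner_succE xy] := succ_rel_onto (modI x) (inner_elt (rF x)).
by exists (sval (sval y)).
Qed.

Let S_fun (x y z : M tt) : S x y -> S x z -> y = z.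
Proof.
have [rF _ _] := F_equiv; move=> xy xz.
suff /(congr1 (fun y => sval (sval y))) : inner_elt (SF xy) = inner_elt (SF xz) by [].
by apply: (succ_rel_fun (modI x) (x := inner_elt (rF x))); apply/inner_succE.
Qed.

Let S_inj (x y z : M tt) : S x y -> S z y -> x = z.
Proof.
have [rF sF _] := F_equiv; move=> xy zy.
suff /(congr1 (fun y => sval (sval y))) :
    inner_elt (sF _ _ (SF xy)) = inner_elt (sF _ _ (SF zy)) by [].
by apply: (succ_rel_inj (modI y) (y := inner_elt (rF y))); apply/inner_succE.
Qed.

Lemma T2_succ : exists2 s : M tt -> M tt, bijective s &
  [/\ forall x y, S x y <-> y = s x, forall x, F x (s x) &
      forall n x, iter n.+1 s x <> x].
Proof.
have [s sP] := choice S_total; have [s' sP'] := choice S_onto.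
have SE x y : S x y <-> y = s x.
  by split=> [xy|->//]; exact: S_fun xy (sP x).
exists s.
  exists s' => x; first by apply: S_inj (sP' _) (sP _).
  by apply/esym/SE; exact: sP'.
have Fs x : F x (s x) by exact/SF/SE.
split=> // n x sx.
have [rF _ tF] := F_equiv.
have Fi k : F x (iter k s x).
  by elim: k => [|k IH]; [exact: rF|apply: tF IH _; exact: Fs].
(* The iterates of index 0 to [n] form a cycle in the inner class of [x]: at the last index [ordS]
   wraps to 0, and the assumption [sx] closes the cycle. *)
apply: (succ_rel_acyclic (modI x) (a := fun i : 'I_n.+1 => inner_elt (Fi i))) => i.
apply/inner_succE/SE => /=; have := ltn_ord i.
rewrite ltnS leq_eqVlt => /predU1P[->|ltin]; first by rewrite modnn -iterS sx.
by rewrite modn_small.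
Qed.

Lemma T2_equiv : [/\ equivalence E, equivalence F & forall x y, F x y -> E x y].
Proof. by []. Qed.

Lemma T2_infinite n : exists a : 'I_n -> M tt,
  forall i j, i != j -> ~ E (a i) (a j).
Proof. exact: class_rel_infinite modM n. Qed.

End Structure.

Variable M : omega_structure JJL.

(** Relations on omega are read off as atomic facts, so that each instance is a Borel condition on
    [M] by [borel_fact]. *)
Definition omega_rel (R : rsym JJL) (a : 'I_(rarity R) -> nat) : Prop :=
  fact_holds M (RelFact a).

Definition elt (n : nat) : M tt :=
  exist _ n (introT eqP (unit_eq (osort M n) tt)).

Lemma eltK (x : M tt) : elt (sval x) = x.
Proof. exact: val_inj. Qed.

Lemma omega_relE R (a : 'I_(rl_arity R) -> nat) :
  @omega_rel R a <-> @rint _ M (interp M) R (fun i => elt (a i)).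
Proof.
split=> [[c [ca Rc]]|Ra]; last by exists (fun i => elt (a i)).
suff <- : (c : 'I_(rl_arity R) -> M tt) = (fun i => elt (a i)) by [].
by apply/funext => i; rewrite -ca eltK.
Qed.

Definition outer_rel x y := @omega_rel None (pairf x y).
Definition inner_rel x y := @omega_rel (Some None) (pairf x y).
Definition step_rel x y := @omega_rel (Some (Some tt)) (pairf x y).

Lemma T2_nested : models M T2 -> exists2 s, nested_successor outer_rel inner_rel s &
  forall x y, step_rel x y <-> y = s x.
Proof.
move=> modM.
have oE x y : outer_rel x y <-> @rint _ M (interp M) None (pairf (elt x) (elt y)).
  by rewrite -(pairf_map elt); exact: omega_relE.
have iE x y : inner_rel x y <-> @rint _ M (interp M) (Some None) (pairf (elt x) (elt y)).
  by rewrite -(pairf_map elt); exact: omega_relE.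
have sE x y : step_rel x y <-> @rint _ M (interp M) (Some (Some tt)) (pairf (elt x) (elt y)).
  by rewrite -(pairf_map elt); exact: omega_relE.
have [[rE symE trE] [rF symF trF] FE] := T2_equiv modM.
have [s [s' ss' s's] [SE Fs acs]] := T2_succ modM.
have iterE n x : iter n (fun x => sval (s (elt x))) x = sval (iter n s (elt x)).
  by elim: n => //= n ->; rewrite eltK.
exists (fun x => sval (s (elt x))).
  split.
  - split=> [x|x y|y x z]; rewrite !oE; [exact: rE|exact: symE|exact: trE].
  - split=> [x|x y|y x z]; rewrite !iE; [exact: rF|exact: symF|exact: trF].
  - by move=> x y; rewrite iE oE; exact: FE.
  - by move=> x; rewrite iE eltK.
  - by exists (fun x => sval (s' (elt x))) => x; rewrite eltK ?ss' ?s's.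
  - by move=> n x; rewrite iterE -{2}[x]/(sval (elt x)) => /val_inj; exact: acs.
  - move=> n; have [a aE] := T2_infinite modM n.
    exists (fun i => sval (a i)) => i j ij.
    by rewrite oE !eltK; exact: aE.
move=> x y; rewrite sE SE; split=> [<-//|->].
by rewrite eltK.
Qed.

End T2Semantics.

Lemma rint_ext (L : rel_language) (M : structure L) R
    (a b : 'I_(rl_arity R) -> M tt) :
  a =1 b -> @rint _ M (interp M) R a <-> @rint _ M (interp M) R b.
Proof. by move=> /funext->. Qed.

Section T2Isomorphism.
Variables M N : omega_structure (jump_language (jump_language succ_language)).

Lemma isomorphic_T2 : isomorphic M N <->
  exists h : nat -> nat, bijective h /\ forall x y,
    [/\ outer_rel M x y <-> outer_rel N (h x) (h y),
        inner_rel M x y <-> inner_rel N (h x) (h y) &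
        step_rel M x y <-> step_rel N (h x) (h y)].
Proof.
split=> [[h [bh _ hR]]|[h [bh hR]]].
  have [g hg gh] := bh tt.
  exists (fun x => sval (h tt (elt M x))); split.
    by exists (fun x => sval (g (elt N x))) => x; rewrite eltK ?hg ?gh.
  move=> x y; split; rewrite /outer_rel /inner_rel /step_rel !omega_relE hR;
    by rewrite -(pairf_map (fun x => sval (h tt (elt M x))));
       apply: rint_ext => i; rewrite eltK.
exists (fun s => match s return M s -> N s with tt => fun x => elt N (h (sval x)) end).
split=> [[]|[]|].
  have [g hg gh] := bh.
  by exists (fun y => elt M (g (sval y))) => x; apply: val_inj; rewrite /= ?hg ?gh.
have hRE (R : rsym (jump_language (jump_language succ_language)))
    (a : 'I_(rl_arity R) -> M tt) :
    (@omega_rel M R (fun i => sval (a i)) <-> @omega_rel N R (fun i => h (sval (a i)))) ->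
    @rint _ M (interp M) R a <-> @rint _ N (interp N) R (fun i => elt N (h (sval (a i)))).
  rewrite !omega_relE => <-.
  by apply: rint_ext => i; rewrite eltK.
have pE (L : omega_structure _) R (b c : 'I_(rl_arity R) -> nat) :
    b =1 c -> @omega_rel L R b <-> @omega_rel L R c by move=> /funext->.
have etaE (b : 'I_2 -> nat) : b =1 pairf (b ord0) (b ord_max).
  by move=> i; rewrite -pairf_eta.
case=> [[[]|]|] a; apply: hRE;
  have [Eh Fh Sh] := hR (sval (a ord0)) (sval (a ord_max)).
- apply: iff_trans (iff_trans _ Sh) _; apply: pE => i.
    exact: (etaE (fun i => sval (a i))).
  exact/esym/(etaE (fun i => h (sval (a i)))).
- apply: iff_trans (iff_trans _ Fh) _; apply: pE => i.
    exact: (etaE (fun i => sval (a i))).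
  exact/esym/(etaE (fun i => h (sval (a i)))).
- apply: iff_trans (iff_trans _ Eh) _; apply: pE => i.
    exact: (etaE (fun i => sval (a i))).
  exact/esym/(etaE (fun i => h (sval (a i)))).
Qed.

End T2Isomorphism.

(** * Models of K given by codes *)

Section Enumeration.
Variables (T : countType) (P : T -> Prop).

Definition hit (k : nat) : bool := `[< exists2 t : T, pickle t = k & P t >].

(** On an infinite [P] this is the order isomorphism, for the order of codes, onto omega. Each value
    depends on finitely many membership conditions, which keeps the enumeration Borel. *)
Definition rank (t : T) : nat := count hit (iota 0 (pickle t)).

Lemma hit_pickle t : P t -> hit (pickle t).
Proof. by move=> Pt; apply/asboolP; exists t. Qed.

Lemma count_hitS k : count hit (iota 0 k.+1) = count hit (iota 0 k) + hit k.
Proof. by rewrite -addn1 iotaD count_cat /= addn0. Qed.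

Lemma count_hit_mono k l : k <= l -> count hit (iota 0 k) <= count hit (iota 0 l).
Proof. by move=> /subnKC <-; rewrite iotaD count_cat leq_addr. Qed.

Lemma rank_lt t t' : P t -> pickle t < pickle t' -> rank t < rank t'.
Proof.
move=> Pt tt'; apply: leq_trans (count_hit_mono tt').
by rewrite count_hitS hit_pickle // addn1.
Qed.

Lemma rank_inj t t' : P t -> P t' -> rank t = rank t' -> t = t'.
Proof.
move=> Pt Pt' rtt'; apply: (pcan_inj pickleK).
case: (ltngtP (pickle t) (pickle t')) => // [/(rank_lt Pt)|/(rank_lt Pt')];
  by rewrite rtt' ltnn.
Qed.

Lemma rank_onto : (forall k, exists2 t, P t & k <= pickle t) ->
  forall n, exists t, P t /\ rank t = n.
Proof.
move=> infP n.
have [k] : exists k, n < count hit (iota 0 k).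
  elim: n => [|n [k nk]].
    have [t Pt _] := infP 0; exists (pickle t).+1.
    by rewrite count_hitS hit_pickle // addn1.
  have [t Pt kt] := infP k; exists (pickle t).+1.
  rewrite count_hitS hit_pickle // addn1 ltnS.
  exact: leq_trans nk (count_hit_mono kt).
(* Where the count first exceeds [n], the last position inspected is the code of an element, and
   exactly [n] elements come before it. *)
elim: k => // k IH; rewrite count_hitS.
have [/IH //|] := ltnP n (count hit (iota 0 k)).
case: (boolP (hit k)) => [/asboolP[t <- Pt] kn|_ kn]; last first.
  by rewrite addn0 ltnNge kn.
rewrite addn1 ltnS => nk; exists t; split=> //.
by apply/eqP; rewrite eqn_leq kn.
Qed.

End Enumeration.

Lemma injective_unbounded (f : nat -> nat) : injective f ->
  forall k, exists n, k <= f n.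
Proof.
move=> injf k; apply: contrapT => nk.
have fk n : f n < k by rewrite ltnNge; apply/negP => kn; apply: nk; exists n.
pose g (i : 'I_k.+1) := Ordinal (fk i).
suff /leq_card : injective g by rewrite !card_ord ltnn.
by move=> i j /(congr1 val) /injf /val_inj.
Qed.

(** Induction on [pickle t]: each further position adds one case distinction on [hit], itself a
    countable union of the given Borel conditions. *)
Lemma borel_rank (X : topologicalType) (T : countType) (P : X -> T -> Prop) :
  (forall t, borel_set (fun x => P x t)) ->
  forall t n, borel_set (fun x => rank (P x) t = n).
Proof.
move=> bP t; rewrite /rank; elim: (pickle t) => [|k IH] n.
  exact: (borel_const (0 = n)).
have bhit : borel_set (fun x => is_true (hit (P x) k)).
  have -> : (fun x => is_true (hit (P x) k)) = (fun x => exists t, pickle t = k /\ P x t).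
    apply/funext => x; apply/propext; split=> [/asboolP[u uk Pu]|[u [uk Pu]]].
      by exists u.
    by apply/asboolP; exists u.
  by apply: borel_exists => u; apply: borel_and => //; exact: borel_const.
have -> : (fun x => count (hit (P x)) (iota 0 k.+1) = n) =
    (fun x => (hit (P x) k /\
               exists m, m.+1 = n /\ count (hit (P x)) (iota 0 k) = m)
           \/ (~ hit (P x) k /\ count (hit (P x)) (iota 0 k) = n)).
  apply/funext => x; apply/propext; rewrite count_hitS.
  split=> [<-|[[-> [m [<- ->]]]|[/negP/negPf-> ->]]]; last 2 first.
  - by rewrite addn1.
  - by rewrite addn0.
  case: (hit (P x) k); [left|right]; rewrite ?addn1 ?addn0; split=> //.
  by exists (count (hit (P x)) (iota 0 k)).
apply: borel_or; apply: borel_and => //; last exact: borel_not.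
apply: borel_exists => m; apply: borel_and => //; exact: borel_const.
Qed.

(* [CV i c u None z] and [CV i c u (Some m) z] are the elements of a fiber of
   [pi_i] over [(c, u)]; [o] names an orbit of the successor and [z] a position
   in this orbit. *)
Inductive code :=
| CU (u : nat)
| CC (i : nat) (b : bool)
| CV (i : nat) (c : seq bool) (u : nat) (o : option nat) (z : int).

Definition code_sum (t : code) :
    nat + nat * bool + nat * seq bool * nat * option nat * int :=
  match t with
  | CU u => inl (inl u)
  | CC i b => inl (inr (i, b))
  | CV i c u o z => inr (i, c, u, o, z)
  end.

Definition sum_code
    (t : nat + nat * bool + nat * seq bool * nat * option nat * int) : code :=
  match t with
  | inl (inl u) => CU u
  | inl (inr (i, b)) => CC i b
  | inr (i, c, u, o, z) => CV i c u o z
  end.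

Lemma code_sumK : cancel code_sum sum_code. Proof. by case. Qed.
HB.instance Definition _ := Countable.copy code (can_type code_sumK).

Definition code_sort (t : code) : Ksort :=
  match t with CU _ => KU | CC i _ => KC i | CV i _ _ _ _ => KV i end.

(** Total on codes, to stay free of dependent types: outside the sort [Kdom f] the value carries no
    meaning. On a valid code of that sort [c] has length [i.+1], and the default of [nth] is not
    reached. *)
Definition code_fun (f : Kfun) (t : code) : code :=
  match f, t with
  | KS _, CV i c u o z => CV i c u o (z + 1)%R
  | Kpi i j, CV _ c u _ _ => if j <= i then CC j (nth false c j) else CU u
  | _, _ => t
  end.

Definition Kdom (f : Kfun) : Ksort :=
  match f with KS i => KV i | Kpi i _ => KV i end.

Lemma code_fun_sort (f : fsym K_language) t :
  code_sort t = Kdom f -> code_sort (code_fun f t) = fcod f.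
Proof. by case: f t => [i|i j] [] //= *; rewrite /Kpi_cod; case: ifP. Qed.

(** * The model of K with base set [U] and added orbits [Q i u] over [u] *)

Section CodedStructure.
Variables (U : nat -> Prop) (Q : nat -> nat -> nat -> Prop).

(** The orbit [None] carries no condition: it keeps the fibers over [u] nonempty even when [Q i u]
    is empty. *)
Definition valid (t : code) : Prop :=
  match t with
  | CU u => U u
  | CC _ _ => True
  | CV i c u o _ =>
      [/\ size c = i.+1, U u & if o is Some m then Q i u m else True]
  end.

Lemma valid_fun f t : valid t -> valid (code_fun f t).
Proof. by case: f t => [i|i j] [] //= ? c u o z []; case: ifP. Qed.

(** The codes of the sorts [KC n] are valid for all [U] and [Q], so the enumeration is available
    before anything is known about these parameters. *)
Lemma valid_unbounded k : exists2 t, valid t & k <= pickle t.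
Proof.
have [|n kn] := @injective_unbounded (fun n => pickle (CC n true)) _ k.
  by move=> m n /(pcan_inj pickleK) [].
by exists (CC n true).
Qed.

Definition enum_code (n : nat) : code :=
  sval (cid (rank_onto valid_unbounded n)).

Lemma enum_valid n : valid (enum_code n).
Proof. by rewrite /enum_code; case: cid => t []. Qed.

Lemma enum_codeK n : rank valid (enum_code n) = n.
Proof. by rewrite /enum_code; case: cid => t []. Qed.

Lemma rankK t : valid t -> enum_code (rank valid t) = t.
Proof.
by move=> vt; apply: rank_inj (enum_valid _) vt _; rewrite enum_codeK.
Qed.

Definition coded_sort (n : nat) : lsort K_language := code_sort (enum_code n).

Definition decode s (x : part coded_sort s) : code := enum_code (sval x).

Lemma decode_valid s (x : part coded_sort s) : valid (decode x).
Proof. exact: enum_valid. Qed.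

Lemma decode_sort s (x : part coded_sort s) : code_sort (decode x) = s.
Proof. by apply/eqP; case: x. Qed.

Lemma decode_inj s : injective (@decode s).
Proof.
by move=> x y xy; apply: val_inj; rewrite /= -[LHS]enum_codeK -[RHS]enum_codeK;
  congr rank.
Qed.

Lemma encode_subproof s t : valid t -> code_sort t = s ->
  coded_sort (rank valid t) == s.
Proof. by move=> vt <-; rewrite /coded_sort rankK. Qed.

Definition encode s t (vt : valid t) (ts : code_sort t = s) : part coded_sort s :=
  exist _ (rank valid t) (encode_subproof vt ts).

Lemma encodeK s t (vt : valid t) (ts : code_sort t = s) :
  decode (encode vt ts) = t.
Proof. exact: rankK. Qed.

Lemma fdom_Kdom (f : fsym K_language) i : fdom f i = Kdom f.
Proof. by case: f i. Qed.

Definition coded_fun (f : fsym K_language)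
    (a : forall i, part coded_sort (fdom f i)) : part coded_sort (fcod f) :=
  let i0 : 'I_(farity f) := @ord0 0 in
  encode (valid_fun f (decode_valid (a i0)))
    (code_fun_sort (etrans (decode_sort (a i0)) (fdom_Kdom i0))).

Definition coded : omega_structure K_language :=
  @OmegaStructure K_language coded_sort
    (Interpretation coded_fun (fun R => match R with end)).

Lemma decode_fun (f : fsym K_language) (a : forall i, coded (fdom f i)) :
  decode (coded_fun a) = code_fun f (decode (a (@ord0 0))).
Proof. exact: encodeK. Qed.

Lemma decode_S i (x : coded (KV i)) :
  @decode (KV i) (@coded_fun (KS i) (fun=> x)) = code_fun (KS i) (decode x).
Proof. exact: decode_fun. Qed.

Lemma decode_pi i (j : 'I_i.+2) (x : coded (KV i)) :
  @decode (Kpi_cod j) (@coded_fun (Kpi j) (fun=> x)) = code_fun (Kpi j) (decode x).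
Proof. exact: decode_fun. Qed.

Lemma decode_V i (x : coded (KV i)) : exists c u o z,
  [/\ decode x = CV i c u o z, size c = i.+1, U u &
      if o is Some m then Q i u m else True].
Proof.
have := decode_sort x; have := decode_valid x.
by case: (decode x) => // j c u o z [? ? ?] [<-]; exists c, u, o, z.
Qed.

Lemma decode_C i (x : coded (KC i)) : exists b, decode x = CC i b.
Proof. by have := decode_sort x; case: (decode x) => // j b [<-]; exists b. Qed.

Hypothesis infU : forall n, exists2 a : 'I_n -> nat,
  injective a & forall i, U (a i).

Let base : exists u, U u.
Proof. by have [a _ aU] := infU 1; exists (a ord0). Qed.

Let sat_distinct s n (a : 'I_n -> coded s)
    (r : forall v, coded (@empty_ctx _ v)) : injective a ->
  let G := ctx_cat (@empty_ctx _) (@block n s) in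
  @sat K_language coded _ G (Conj (fun i : 'I_n => Conj (fun j : 'I_n =>
      if i == j then Imp Bot Bot
      else Not (@KEq _ G s (Var (inr i)) (Var (inr j))))))
    (@val_cat _ _ coded _ _ (@block n s) r a).
Proof.
move=> inja; apply/sat_Conj => i; apply/sat_Conj => j.
by case: eqP => [_ //|ij] /= /inja.
Qed.

Let K_term V (G : V -> lsort K_language) (r : forall v, coded (G v)) i n
    (t : term G (KV i)) c u o z :
  decode (term_eval r t) = CV i c u o z ->
  decode (term_eval r (iter n (@Sapp _ _ i) t)) = CV i c u o (z + Posz n)%R.
Proof.
move=> tE; elim: n => [|n IH]; first by rewrite GRing.addr0.
rewrite iterS [term_eval _ _]/= decode_S IH /=.
by rewrite -GRing.addrA; congr (CV _ _ _ _ (_ + _)%R); rewrite -addn1.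
Qed.

Lemma coded_models : models coded K.
Proof.
move=> p [n|i n|i|i|i|i|i n|i j].
- have [a inja aU] := infU n.
  pose b i : coded KU := encode (t := CU (a i)) (aU i) erefl.
  exists b; apply: sat_distinct => i j /(congr1 (@decode _)).
  by rewrite !encodeK => -[/inja].
- have [u Uu] := base.
  (* Infinitely many elements are found on a single orbit, as its positions. *)
  have v z : valid (CV i (nseq i.+1 false) u None z) by split; rewrite ?size_nseq.
  pose b (j : 'I_n) : coded (KV i) := encode (v (Posz j)) erefl.
  exists b; apply: sat_distinct => j k /(congr1 (@decode _)).
  by rewrite !encodeK => -[]/val_inj.
- pose b (j : 'I_2) : coded (KC i) := encode (t := CC i (j == ord0)) I erefl.
  exists b; split=> [|a] /=.
    by move=> /(congr1 (@decode _)); rewrite !encodeK.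
  have [[] aE] := decode_C (a (@Ordinal 1 0 isT)); [left|right];
    by apply: decode_inj; rewrite encodeK.
- move=> a.
  (* The tuple [a] prescribes the coordinates: its entries of index at most [i] are codes [CC j b],
     giving [c], and its last entry is a code [CU u]. The witness sits on the orbit [None] over
     them, at position 0. *)
  pose c := mkseq (fun j => if decode (a (inord j)) is CC _ b then b else false) i.+1.
  have [u am Uu] : exists2 u, decode (a ord_max) = CU u & U u.
    have sE : Kpi_cod (@ord_max i.+1) = KU by rewrite /Kpi_cod ltnn.
    have := etrans (decode_sort (a ord_max)) sE; have := decode_valid (a ord_max).
    by case: (decode (a ord_max)) => // u; exists u.
  have vt : valid (CV i c u None 0) by split; rewrite ?size_mkseq.
  exists (fun=> encode vt erefl); apply/sat_Conj => j /=.
  apply: decode_inj; rewrite decode_pi encodeK /=.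
  case: ifP => ji.
    rewrite nth_mkseq // inord_val.
    have sE : Kpi_cod j = KC j by rewrite /Kpi_cod ji.
    have := etrans (decode_sort (a j)) sE.
    by case: (decode (a j)) => // k b [->].
  suff -> : j = ord_max by [].
  by apply: val_inj => /=; have := ltn_ord j; lia.
- move=> a /= /(congr1 (@decode _)); rewrite !decode_S => e.
  apply: decode_inj; move: e.
  have [c [u [o [z [-> _ _ _]]]]] := decode_V (a (@Ordinal 2 0 isT)).
  have [c' [u' [o' [z' [-> _ _ _]]]]] := decode_V (a (@Ordinal 2 1 isT)).
  by move=> /= [-> -> -> /GRing.addIr->].
- move=> a.
  have [c [u [o [z [aE ci Uu Qo]]]]] := decode_V (a (@Ordinal 1 0 isT)).
  have vt : valid (CV i c u o (z - 1)) by [].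
  exists (fun=> encode vt erefl); apply: decode_inj.
  by rewrite /= decode_S encodeK aE /= GRing.subrK.
- move=> a; rewrite /Not sat_Imp => /(congr1 (@decode _)).
  have [c [u [o [z [aE _ _ _]]]]] := decode_V (a (@Ordinal 1 0 isT)).
  rewrite (@K_term _ _ _ _ _ _ c u o z) //= aE => -[].
  lia.
- move=> a; apply: decode_inj; rewrite /= !decode_pi decode_S.
  by have [c [u [o [z [-> _ _ _]]]]] := decode_V (a (@Ordinal 1 0 isT)).
Qed.

End CodedStructure.

(** * Isomorphisms between coded structures *)

Definition bij_on (T T' : Type) (A : T -> Prop) (B : T' -> Prop)
    (f : T -> T') (g : T' -> T) : Prop :=
  (forall x, A x -> B (f x) /\ g (f x) = x) /\
  (forall y, B y -> A (g y) /\ f (g y) = y).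

Lemma bij_onC (T T' : Type) (A : T -> Prop) (B : T' -> Prop) f g :
  bij_on A B f g -> bij_on B A g f.
Proof. by case. Qed.

Definition or_None (A : nat -> Prop) (o : option nat) : Prop :=
  if o is Some m then A m else True.

(** Cancels the added orbit, which an isomorphism may well move: the element sent to [None], if
    there is one, is rerouted to the image of [None]. *)
Lemma bij_on_or_None (A B : nat -> Prop) f g :
  bij_on (or_None A) (or_None B) f g -> exists f' g', bij_on A B f' g'.
Proof.
(* The value 0 would need both [Some m] and [None] to be sent to [None], which injectivity excludes
   when [m] lies in the domain. *)
pose drop (f : option nat -> option nat) m :=
  if f (Some m) is Some n then n else if f None is Some n then n else 0.
have half (A' B' : nat -> Prop) f' g' : bij_on (or_None A') (or_None B') f' g' ->
    forall x, A' x -> B' (drop f' x) /\ drop g' (drop f' x) = x.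
  move=> [fP gP] x Ax; rewrite /drop.
  have := fP (Some x) Ax; case: (f' (Some x)) => [y [By gy]|[_ gN]].
    by rewrite gy.
  have := fP None I; case: (f' None) => [y [By gy]|[_]]; last by rewrite gN.
  by rewrite gy gN.
move=> fg; exists (drop f), (drop g).
by split; apply: half => //; exact: bij_onC.
Qed.

Definition code_iso (V V' : code -> Prop) (H : code -> code) : Prop :=
  [/\ forall t, V t -> V' (H t), forall t, V t -> code_sort (H t) = code_sort t &
      forall f t, V t -> code_sort t = Kdom f -> H (code_fun f t) = code_fun f (H t)].

Section CodedIsomorphism.
Variables (U : nat -> Prop) (Q : nat -> nat -> nat -> Prop).
Variables (U' : nat -> Prop) (Q' : nat -> nat -> nat -> Prop).

Lemma decode_onto t : valid U Q t -> exists x : coded U Q (code_sort t), decode x = t.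
Proof. by move=> vt; exists (encode vt erefl); exact: encodeK. Qed.

(** Turns a sort-indexed family into one map on codes, so that maps can be compared without
    transports. Only commutation with the functions is assumed, which lets the lemma serve for an
    isomorphism and for its inverse. *)
Lemma isomorphic_code_iso (h : forall s, coded U Q s -> coded U' Q' s) :
  (forall (f : fsym K_language) a, h (fcod f) (fint (interp (coded U Q)) f a) =
     fint (interp (coded U' Q')) f (fun i => h (fdom f i) (a i))) ->
  exists2 H, code_iso (valid U Q) (valid U' Q') H &
    forall s (x : coded U Q s), H (decode x) = decode (h s x).
Proof.
move=> hf.
pose H t := if pselect (valid U Q t) is left vt then
  decode (h (code_sort t) (encode vt erefl)) else t.
have HE s (x : coded U Q s) : H (decode x) = decode (h s x).
  have := decode_sort x; move: (decode_valid x); move: (erefl (decode x)).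
  move: {1 3 4 5}(decode x) => t xt vt ts; case: s / ts x xt => x xt.
  rewrite /H; case: pselect => // vt'; congr (decode (h _ _)).
  by apply: decode_inj; rewrite encodeK.
exists H => //; split=> [t /decode_onto[x <-]|t /decode_onto[x xt]|f t vt tf].
- by rewrite HE; exact: decode_valid.
- by rewrite -{1}xt HE decode_sort.
have [x xt] := decode_onto vt; case: _ / (esym tf) x xt => {tf}.
case: f => [i|i j] x <-.
  by rewrite -decode_S !HE -decode_S; congr (decode _); exact: (hf (KS i)).
by rewrite -decode_pi !HE -decode_pi; congr (decode _); exact: (hf (Kpi j)).
Qed.

Lemma code_iso_isomorphic (H H' : code -> code) :
  code_iso (valid U Q) (valid U' Q') H ->
  bij_on (valid U Q) (valid U' Q') H H' ->
  isomorphic (coded U Q) (coded U' Q').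
Proof.
move=> [HV Hs Hf] [HK HK'].
pose h s (x : coded U Q s) : coded U' Q' s :=
  encode (HV _ (decode_valid x)) (etrans (Hs _ (decode_valid x)) (decode_sort x)).
have hE s x : decode (h s x) = H (decode x) by exact: encodeK.
exists h; split=> [s|f a|[]].
  have Hs' t : valid U' Q' t -> code_sort (H' t) = code_sort t.
    by move=> /HK'[vt {2}<-]; rewrite Hs.
  pose g (y : coded U' Q' s) : coded U Q s :=
    encode (proj1 (HK' _ (decode_valid y)))
      (etrans (Hs' _ (decode_valid y)) (decode_sort y)).
  exists g => x; apply: decode_inj.
    by rewrite encodeK hE; have [] := HK _ (decode_valid x).
  by rewrite hE encodeK; have [] := HK' _ (decode_valid x).
apply: decode_inj.
rewrite hE [in LHS]decode_fun [RHS]decode_fun hE Hf //; first exact: decode_valid.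
by rewrite decode_sort; exact: fdom_Kdom.
Qed.

End CodedIsomorphism.

(** Commutation with the projections makes [c'] and [u'] depend on [c] and [u] only, through the
    images of [CC j _] and [CU u]. Commutation with the successor then makes the map a translation
    by some [k] on each orbit. *)
Lemma orbit_map U Q U' Q' H i c u :
  code_iso (valid U Q) (valid U' Q') H -> size c = i.+1 -> U u ->
  exists c' u', [/\ size c' = i.+1, H (CU u) = CU u', U' u' &
    forall o, or_None (Q i u) o -> exists o' k, or_None (Q' i u') o' /\
      forall z, H (CV i c u o z) = CV i c' u' o' (z + k)%R].
Proof.
move=> [HV Hs Hf] ci Uu.
have v o z : or_None (Q i u) o -> valid U Q (CV i c u o z) by case: o.
have HE o z : or_None (Q i u) o -> exists c' u' o' z',
    [/\ H (CV i c u o z) = CV i c' u' o' z', size c' = i.+1, U' u' &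
        or_None (Q' i u') o'].
  move=> Qo; have := Hs _ (v o z Qo); have := HV _ (v o z Qo).
  case: (H _) => //= j c' u' o' z' [? ? ?] [<-].
  by exists c', u', o', z'.
(* The orbit [None] is always there, so [c'] and [u'] can be read from its point at position 0. *)
have [c' [u' [o1 [z1 [H0 c'i U'u' _]]]]] := HE None 0%R I.
have Hu o z c2 u2 o2 z2 : or_None (Q i u) o ->
    H (CV i c u o z) = CV i c2 u2 o2 z2 -> H (CU u) = CU u2.
  move=> Qo e; have := Hf (@Kpi i ord_max) _ (v o z Qo) erefl.
  by rewrite e /= ltnn.
have Hc o z c2 u2 o2 z2 : or_None (Q i u) o -> H (CV i c u o z) = CV i c2 u2 o2 z2 ->
    forall j, j <= i -> H (CC j (nth false c j)) = CC j (nth false c2 j).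
  move=> Qo e j ji; have ji2 : j < i.+2 by lia.
  have := Hf (@Kpi i (Ordinal ji2)) _ (v o z Qo) erefl.
  by rewrite e /= ji.
exists c', u'; split=> // [|o Qo]; first exact: Hu H0.
have {}HE z : exists2 oz, or_None (Q' i u') oz.1 &
    H (CV i c u o z) = CV i c' u' oz.1 oz.2.
  have [c2 [u2 [o2 [z2 [e c2i U2 Q2]]]]] := HE o z Qo.
  have eu : u2 = u' by have := Hu _ _ _ _ _ _ Qo e; rewrite (Hu _ _ _ _ _ _ _ H0) // => -[].
  have ec : c2 = c'.
    apply: (@eq_from_nth _ false) => [|j]; first by rewrite c2i c'i.
    rewrite c2i ltnS => ji; have := Hc _ _ _ _ _ _ Qo e j ji.
    by rewrite (Hc _ _ _ _ _ _ _ H0) // => -[].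
  by exists (o2, z2); rewrite -?eu // -ec.
have [oz0 Q0 E0] := HE 0%R; exists oz0.1, oz0.2; split=> //.
have step z : H (CV i c u o (z + 1)) = code_fun (KS i) (H (CV i c u o z)).
  by rewrite -(Hf (KS i) _ (v o z Qo)).
elim/int_ind => [|n IH|n IH].
- by rewrite GRing.add0r.
- by rewrite -addn1 PoszD step IH /=; congr CV; lia.
- have := step (- n.+1%:Z)%R; have -> : (- n.+1%:Z + 1 = - n%:Z)%R by lia.
  rewrite IH; have [[o2 z2] _ ->] := HE (- n.+1%:Z)%R => /= -[-> ?].
  by congr CV; lia.
Qed.

Lemma isomorphic_coded U Q U' Q' :
  isomorphic (coded U Q) (coded U' Q') <->
  exists f g, bij_on U U' f g /\ forall i u, U u ->
    exists f' g', bij_on (Q i u) (Q' i (f u)) f' g'.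
Proof.
split=> [[h [bh hf _]]|[f [g [[fP gP] fiber]]]].
  have exk s : exists k, cancel (h s) k /\ cancel k (h s).
    by case: (bh s) => k; exists k.
  pose k s := sval (cid (exk s)).
  have kP s : cancel (h s) (k s) /\ cancel (k s) (h s) by rewrite /k; case: cid.
  have kf (f : fsym K_language) a : k (fcod f) (fint (interp (coded U' Q')) f a) =
      fint (interp (coded U Q)) f (fun i => k (fdom f i) (a i)).
    have [kK _] := kP (fcod f); rewrite -[RHS]kK hf; congr (k _ (fint _ f _)).
    apply: functional_extensionality_dep => i.
    by have [_ ->] := kP (fdom f i).
  have [H isoH HE] := isomorphic_code_iso hf.
  have [H' isoH' HE'] := isomorphic_code_iso kf.
  have HK t : valid U Q t -> H' (H t) = t.
    by move=> /decode_onto[x xt]; rewrite -xt HE HE' (proj1 (kP _)).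
  have HK' t : valid U' Q' t -> H (H' t) = t.
    by move=> /decode_onto[x xt]; rewrite -xt HE' HE (proj2 (kP _)).
  (* The default 0 is not reached on [U], where the image of a base code is a base code; below, any
     tuple of length 1 gives access to [orbit_map]. *)
  pose point (H : code -> code) u := if H (CU u) is CU v then v else 0.
  exists (point H), (point H'); split.
    split=> u Uu; rewrite /point.
      have [_ [v [_ e Uv _]]] := orbit_map isoH (erefl : size [:: true] = 1) Uu.
      by rewrite e -e HK.
    have [_ [v [_ e Uv _]]] := orbit_map isoH' (erefl : size [:: true] = 1) Uu.
    by rewrite e -e HK'.
  move=> i u Uu; rewrite /point.
  (* All fibers over [u] have the same orbit names, so one tuple suffices. Its image [c'] may differ
     from it, since elements of the [C_j] may be exchanged. *)
  have [c' [u' [c'i e Uu' orb]]] := orbit_map isoH (size_nseq i.+1 true) Uu.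
  have [c2 [u2 [_ e2 _ orb']]] := orbit_map isoH' c'i Uu'.
  have eu : u2 = u by move: e2; rewrite -e HK // => -[].
  rewrite {}eu in orb' *; rewrite e {e2}.
  have /choice[A AP] o : exists o', or_None (Q i u) o -> or_None (Q' i u') o' /\
      exists k, forall z, H (CV i (nseq i.+1 true) u o z) = CV i c' u' o' (z + k)%R.
    have [/orb[o' [k' [? ?]]]|no] := pselect (or_None (Q i u) o); last by exists None.
    by exists o' => _; split=> //; exists k'.
  have /choice[B BP] o : exists o', or_None (Q' i u') o -> or_None (Q i u) o' /\
      exists k, forall z, H' (CV i c' u' o z) = CV i c2 u o' (z + k)%R.
    have [/orb'[o' [k' [? ?]]]|no] := pselect (or_None (Q' i u') o); last by exists None.
    by exists o' => _; split=> //; exists k'.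
  (* Comparing coordinates in [H' (H t) = t] yields both facts: the tuple returns to the constant
     one, and the maps on orbit names are inverse to each other. *)
  have BA o : or_None (Q i u) o -> c2 = nseq i.+1 true /\ B (A o) = o.
    move=> Qo; have [QA [a AE]] := AP o Qo; have [QB [b BE]] := BP _ QA.
    have vt : valid U Q (CV i (nseq i.+1 true) u o 0%R).
      by split; rewrite ?size_nseq //; case: (o) Qo.
    by have := HK _ vt; rewrite AE BE => -[-> ->].
  have [c2E _] := BA None I.
  apply: (@bij_on_or_None _ _ A B); split=> o Qo.
    by have [] := AP o Qo; have [] := BA o Qo.
  have [QB [b BE]] := BP o Qo; have [QA [a AE]] := AP _ QB.
  have vt : valid U' Q' (CV i c' u' o 0%R) by case: (o) Qo.
  by split=> //; have := HK' _ vt; rewrite BE c2E AE => -[->].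
have /choice[FG FGP] (iu : nat * nat) : exists fg : (nat -> nat) * (nat -> nat),
    U iu.2 -> bij_on (Q iu.1 iu.2) (Q' iu.1 (f iu.2)) fg.1 fg.2.
  have [/(fiber iu.1)[f' [g' fg']]|nU] := pselect (U iu.2); last by exists (id, id).
  by exists (f', g').
(* Identity on the [C_j] and on positions, with [None] fixed; only base points and the remaining
   orbit names are changed. *)
pose H t := match t with
  | CU u => CU (f u)
  | CC i b => CC i b
  | CV i c u o z => CV i c (f u) (omap (FG (i, u)).1 o) z end.
pose H' t := match t with
  | CU u => CU (g u)
  | CC i b => CC i b
  | CV i c u o z => CV i c (g u) (omap (FG (i, g u)).2 o) z end.
apply: (@code_iso_isomorphic _ _ _ _ H H'); first split.
- case=> [u|i b|i c u o z] //=; first by case/fP.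
  move=> [ci Uu Qo]; split=> //; first by case/fP: Uu.
  by case: o Qo => //= m Qm; have [+ _] := FGP (i, u) Uu; case/(_ m Qm).
- by case.
- by case=> [i|i j] [] //= ? ? ? ? ? _ _; case: ifP.
split=> -[u|i b|i c u o z] //=.
- by move=> /[dup] Uu /fP[? ->].
- move=> [ci Uu Qo]; have [fu gu] := fP u Uu; rewrite gu.
  have [FGu _] := FGP (i, u) Uu.
  split; last by case: o Qo => //= m /FGu[_ ->].
  by split=> //; case: o Qo => //= m /FGu[].
- by move=> /[dup] Uu /gP[? ->].
- move=> [ci Uu Qo]; have [gu fu] := gP u Uu; rewrite fu.
  have [_] := FGP (i, g u) gu; rewrite /= fu => FGu.
  split; last by case: o Qo => //= m /FGu[_ ->].
  by split=> //; case: o Qo => //= m /FGu[].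
Qed.

(** * Invariants of models of T2 *)

(** The least element of its class, a representative that is Borel in [R], unlike one given by
    choice. *)
Definition leader (R : nat -> nat -> Prop) (x : nat) : Prop :=
  forall y, y < x -> ~ R x y.

(* [i = 0] stands for infinity. *)
Definition count_is (A : nat -> Prop) (i : nat) : Prop :=
  if i is 0 then ~ exists l : seq nat, forall x, A x -> x \in l
  else exists l : seq nat, [/\ uniq l, size l = i & forall x, x \in l <-> A x].

(** Nonemptiness is essential: 0 is taken by infinity, so the empty set has no count. *)
Lemma count_is_total (A : nat -> Prop) : (exists x, A x) ->
  exists i, count_is A i.
Proof.
move=> [x Ax]; have [[l lA]|nl] := pselect (exists l : seq nat, forall x, A x -> x \in l);
  last by exists 0.
pose l' := undup [seq x <- l | `[< A x >]].
have l'P y : y \in l' <-> A y.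
  rewrite mem_undup mem_filter; split=> [/andP[/asboolP//]|Ay].
  by rewrite lA // andbT; apply/asboolP.
exists (size l'); have : x \in l' by apply/l'P.
have : uniq l' by exact: undup_uniq.
by move: l' l'P => [//|a l'] l'P ul _; exists (a :: l').
Qed.

Lemma count_is_unique A i j : count_is A i -> count_is A j -> i = j.
Proof.
case: i j => [|i] [|j] //= => [nA [l [_ _ lA]]|[l [_ _ lA]] nA|[l [ul <- lA]] [l' [ul' <- lA']]].
- by case: nA; exists l => x /lA.
- by case: nA; exists l => x /lA.
apply/perm_size/uniq_perm => // x.
by apply/idP/idP => [/lA/lA'|/lA'/lA].
Qed.

Lemma count_is_bij_on A B f g i : bij_on A B f g -> count_is A i -> count_is B i.
Proof.
move=> [fP gP]; case: i => [|i] /=.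
  move=> nA [l lB]; apply: nA; exists (map g l) => x /fP[/lB fx <-].
  exact: map_f.
move=> [l [ul li lA]]; exists (map f l); split.
- rewrite map_inj_in_uniq // => x y /lA/fP[_ gfx] /lA/fP[_ gfy] fxy.
  by rewrite -gfx fxy.
- by rewrite size_map.
move=> y; split=> [/mapP[x /lA/fP[Bfx _] ->//]|/gP[/lA gy <-]].
exact: map_f.
Qed.

Lemma bij_on_trans (T T' T'' : Type) (A : T -> Prop) (B : T' -> Prop)
    (C : T'' -> Prop) f g f' g' :
  bij_on A B f g -> bij_on B C f' g' -> bij_on A C (f' \o f) (g \o g').
Proof.
move=> [fP gP] [fP' gP']; split=> [x /fP[/fP'[? e] gf]|x /gP'[/gP[? e] fg]] /=.
  by rewrite e.
by rewrite e.
Qed.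

Lemma bij_on_rank (A : nat -> Prop) : count_is A 0 ->
  exists f g, bij_on A (fun _ : nat => True) f g.
Proof.
move=> nA.
have unb k : exists2 t, A t & k <= pickle t.
  apply: contrapT => nk; apply: nA.
  exists (pmap unpickle (iota 0 k)) => x Ax.
  rewrite mem_pmap; apply/mapP; exists (pickle x); last by rewrite pickleK.
  rewrite mem_iota add0n ltnNge; apply/negP => kx.
  by apply: nk; exists x.
have /choice[g gP] := rank_onto unb.
exists (rank A), g; split=> [x Ax|n _]; last exact: gP.
split=> //; have [Ag rg] := gP (rank A x).
exact: rank_inj Ag Ax rg.
Qed.

Lemma count_is_equipotent A B i : count_is A i -> count_is B i ->
  exists f g, bij_on A B f g.
Proof.
case: i => [/bij_on_rank[f [g fg]] /bij_on_rank[f' [g' fg']]|i].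
  by exists (g' \o f), (g \o f'); exact: bij_on_trans fg (bij_onC fg').
have half (l l' : seq nat) (A' B' : nat -> Prop) : uniq l' -> size l = i.+1 ->
    size l' = i.+1 -> (forall x, x \in l <-> A' x) -> (forall x, x \in l' <-> B' x) ->
    forall x, A' x -> B' (nth 0 l' (index x l)) /\
      nth 0 l (index (nth 0 l' (index x l)) l') = x.
  move=> ul' li li' lA lB x /lA xl.
  have xi : index x l < size l' by rewrite li' -li index_mem.
  by split; [apply/lB; exact: mem_nth|rewrite index_uniq // nth_index].
move=> [l [ul li lA]] [l' [ul' li' lB]].
exists (fun x => nth 0 l' (index x l)), (fun x => nth 0 l (index x l')).
by split; apply: half.
Qed.

Lemma bij_on_iff (T T' : Type) (A A2 : T -> Prop) (B B2 : T' -> Prop) f g :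
  (forall x, A x <-> A2 x) -> (forall y, B y <-> B2 y) ->
  bij_on A B f g -> bij_on A2 B2 f g.
Proof.
by move=> AE BE [fP gP]; split=> x; [move=> /AE/fP|move=> /BE/gP] => -[? ?];
  split=> //; [apply/BE|apply/AE].
Qed.

(** [A] is fibered over [I] by [p] and [B] over [I'] by [q]; bijections of fibers above a bijection
    of bases are chosen and assembled. [Z] carries a property of the fiber maps through this
    choice. *)
Lemma bij_on_glue (A B I I' : nat -> Prop) (p q f0 g0 : nat -> nat)
    (Z : nat -> (nat -> nat) -> Prop) :
  bij_on I I' f0 g0 -> (forall x, A x -> I (p x)) -> (forall y, B y -> I' (q y)) ->
  (forall i, I i -> exists f g, Z i f /\
     bij_on (fun x => A x /\ p x = i) (fun y => B y /\ q y = f0 i) f g) ->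
  exists f g, [/\ bij_on A B f g, forall x, A x -> q (f x) = f0 (p x) &
    forall i, I i -> exists2 f', Z i f' & forall x, A x -> p x = i -> f x = f' x].
Proof.
move=> [f0P g0P] Ap Bq fib.
have /choice[F FP] i : exists fg : (nat -> nat) * (nat -> nat), I i ->
    Z i fg.1 /\ bij_on (fun x => A x /\ p x = i) (fun y => B y /\ q y = f0 i) fg.1 fg.2.
  have [/fib[f [g [Zf fg]]]|nI] := pselect (I i); last by exists (id, id).
  by exists (f, g).
have fP x : A x -> [/\ B ((F (p x)).1 x), q ((F (p x)).1 x) = f0 (p x) &
    (F (p x)).2 ((F (p x)).1 x) = x].
  by move=> Ax; have [_ [/(_ x)[//|[? ?] ?] _]] := FP (p x) (Ap x Ax).
exists (fun x => (F (p x)).1 x), (fun y => (F (g0 (q y))).2 y); split.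
- split=> [x Ax|y By].
    have [Bf qf gf] := fP x Ax; split=> //.
    by rewrite qf (proj2 (f0P _ (Ap x Ax))).
  have [Ig fg] := g0P _ (Bq y By).
  have [_ [_ /(_ y)[|[Ag pg] e]]] := FP _ Ig; first by rewrite fg.
  by rewrite pg.
- by move=> x /fP[].
- by move=> i Ii; exists (F i).1 => [|x _ ->//]; have [] := FP i Ii.
Qed.

Lemma leader_exists (R : nat -> nat -> Prop) : equivalence R ->
  exists rep : nat -> nat, [/\ forall x, leader R (rep x),
    forall x, R x (rep x), forall x y, R x y <-> rep x = rep y &
    forall x, leader R x -> rep x = x].
Proof.
move=> [rR sR tR].
have /choice[rep repP] x : exists y, R x y /\ leader R y.
  have ex : exists y, `[< R x y >] by exists x; apply/asboolP.
  exists (ex_minn ex); case: ex_minnP => y /asboolP xy miny; split=> // z zy yz.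
  have /miny : `[< R x z >].
    by apply/asboolP; exact: (tR _ _ _ xy yz).
  by rewrite leqNgt zy.
have leaderI x y : R x y -> leader R x -> leader R y -> x = y.
  move=> xy Lx Ly; case: (ltngtP x y) => // [/Ly|/Lx]; last by case.
  by case; exact: sR.
have repR x := proj1 (repP x); have repL x := proj2 (repP x).
exists rep; split=> // [x y|x Lx].
  split=> [xy|e]; last by apply: (tR _ _ _ (repR x)); rewrite e; exact: sR.
  apply: leaderI => //; apply: (tR _ _ _ (sR _ _ (repR x))).
  exact: (tR _ _ _ xy (repR y)).
by apply: leaderI => //; exact: sR.
Qed.

(** The bijection [h] respects classes but not the order of the naturals, so it need not send
    leaders to leaders; [f] sends [x] to the leader of the class of [h x]. *)
Lemma leader_bij (R R' : nat -> nat -> Prop) (X X' : nat -> Prop) h g :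
  equivalence R -> equivalence R' -> cancel h g -> cancel g h ->
  (forall x y, R x y <-> R' (h x) (h y)) ->
  (forall x y, R x y -> X x -> X y) -> (forall x y, R' x y -> X' x -> X' y) ->
  (forall x, X x <-> X' (h x)) ->
  exists f f', bij_on (fun x => X x /\ leader R x) (fun y => X' y /\ leader R' y) f f'
    /\ forall x, R' (h x) (f x).
Proof.
move=> eR eR' hg gh RR' XR XR' XX'.
have [rep [repL repR repE repI]] := leader_exists eR.
have [rep' [repL' repR' repE' repI']] := leader_exists eR'.
have [_ sR _] := eR; have [_ sR' _] := eR'.
exists (rep' \o h), (rep \o g); split=> //; split=> [x [Xx Lx]|y [Xy Ly]] /=.
  split; first by split=> //; apply: XR' (repR' _) _; apply/XX'.
  rewrite -[RHS]repI //; apply/repE/RR'; rewrite gh; exact: sR'.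
split; first by split=> //; apply: XR (repR _) _; apply/XX'; rewrite gh.
rewrite -[RHS]repI' //; apply/repE'; rewrite -{2}[y]gh; apply/RR'; exact: sR.
Qed.

(** * Orbits of an acyclic bijection as copies of the integers *)

Section IntegerAction.
Variables (s t : nat -> nat).
Hypotheses (st : cancel s t) (ts : cancel t s).
Hypothesis acyclic : forall n x, iter n.+1 s x <> x.

Definition zact (z : int) (x : nat) : nat :=
  match z with Posz n => iter n s x | Negz n => iter n.+1 t x end.

Lemma zactS z x : zact (z + 1)%R x = s (zact z x).
Proof.
case: z => [n|[|n]]; first by rewrite -PoszD addn1.
  by rewrite /= ts.
have -> : (Negz n.+1 + 1 = Negz n)%R by lia.
by rewrite /= ts.
Qed.

(** The action is free: two integers differ by some natural [n], and equal values would give a cycle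
    of length [n] unless [n = 0]. *)
Lemma zact_inj z w x : zact z x = zact w x -> z = w.
Proof.
have half z' (n : nat) : zact (z' + n%:Z)%R x = zact z' x -> n = 0.
  have -> : zact (z' + n%:Z)%R x = iter n s (zact z' x).
    elim: n => [|n IH]; first by rewrite GRing.addr0.
    by rewrite -addn1 PoszD GRing.addrA zactS IH addn1.
  by case: n => // n /acyclic.
have [[n ->]|[n ->]] : (exists n, w = (z + Posz n)%R) \/ (exists n, z = (w + Posz n)%R).
  have [zw|wz] : ((z <= w) \/ (w <= z))%R by lia.
    by left; exists (absz (w - z)); lia.
  by right; exists (absz (z - w)); lia.
- by move=> /esym/half->; rewrite GRing.addr0.
- by move=> /half->; rewrite GRing.addr0.
Qed.

(** Phrased with forward iterates in either direction, so that the graph of [s] alone expresses it,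
    as in [orbit_rel]. *)
Definition orbit_of (x y : nat) : Prop :=
  exists n, y = iter n s x \/ x = iter n s y.

Lemma orbit_zact x y : orbit_of x y <-> exists z, y = zact z x.
Proof.
split=> [[n [->|->]]|[[n|n] ->]].
- by exists (Posz n).
- have iterK : iter n t (iter n s y) = y.
    by elim: n => // n IH; rewrite iterSr iterS st.
  by case: n iterK => [|n] /esym iterK; [exists (Posz 0)|exists (Negz n)].
- by exists n; left.
- have iterK m : iter m s (iter m t x) = x.
    by elim: m => // m IH; rewrite iterSr iterS ts.
  by exists n.+1; right; exact/esym/(iterK n.+1).
Qed.

Lemma orbit_equiv : equivalence orbit_of.
Proof.
have addz z w x : zact z (zact w x) = zact (z + w)%R x.
  elim/int_ind: z => [|n IH|n IH]; first by rewrite GRing.add0r.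
    by rewrite -addn1 PoszD zactS IH -zactS; congr zact; lia.
  have := zactS (- n.+1%:Z)%R (zact w x).
  have -> : (- n.+1%:Z + 1 = - n%:Z)%R by lia.
  rewrite IH; have -> : (- n%:Z + w = (- n.+1%:Z + w) + 1)%R by lia.
  by rewrite zactS => /(can_inj st).
split=> [x|x y [n H]|y x z].
- by exists 0; left.
- by exists n; case: H; [right|left].
- move=> /orbit_zact[k ->] /orbit_zact[l ->]; apply/orbit_zact.
  by exists (l + k)%R.
Qed.

Lemma orbit_succ x : orbit_of x (s x).
Proof. by exists 1; left. Qed.

End IntegerAction.

(** Relative to its base point each orbit is a copy of the integers; the map keeps the integer
    position and changes the base point. *)
Lemma orbit_bij s t s' t' o o' :
  cancel s t -> cancel t s -> (forall n x, iter n.+1 s x <> x) ->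
  cancel s' t' -> cancel t' s' -> (forall n x, iter n.+1 s' x <> x) ->
  exists f g, (forall x, orbit_of s o x -> f (s x) = s' (f x)) /\
    bij_on (orbit_of s o) (orbit_of s' o') f g.
Proof.
move=> st ts acs st' ts' acs'.
have pos s1 t1 (st1 : cancel s1 t1) (ts1 : cancel t1 s1)
    (ac1 : forall n x, iter n.+1 s1 x <> x) o1 : exists p : nat -> int,
    (forall x, orbit_of s1 o1 x -> zact s1 t1 (p x) o1 = x) /\
    (forall z, p (zact s1 t1 z o1) = z).
  have /choice[p pP] x : exists z, orbit_of s1 o1 x -> zact s1 t1 z o1 = x.
    have [/(orbit_zact st1 ts1)[z ->]|no] := pselect (orbit_of s1 o1 x).
      by exists z.
    by exists 0%R.
  exists p; split=> // z; apply: (zact_inj ts1 ac1 (x := o1)); apply: pP.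
  by apply/(orbit_zact st1 ts1); exists z.
have [p [pK pz]] := pos _ _ st ts acs o.
have [p' [pK' pz']] := pos _ _ st' ts' acs' o'.
exists (fun x => zact s' t' (p x) o'), (fun y => zact s t (p' y) o); split.
  move=> x /pK xE; rewrite -(zactS ts'); congr zact.
  by rewrite -{1}xE -(zactS ts) pz.
split=> [x ox|x ox].
  by rewrite pz' pK //; split=> //; apply/(orbit_zact st' ts'); exists (p x).
by rewrite pz pK' //; split=> //; apply/(orbit_zact st ts); exists (p' x).
Qed.

(** * The reduction *)

(** An orbit is named by its least point, which turns the orbits of an inner class into a set of
    naturals to which [count_is] applies. *)
Definition orbits (F O : nat -> nat -> Prop) (m o : nat) : Prop :=
  F m o /\ leader O o.

(* [m] represents an inner class of the outer class of [u] made of exactly [i]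
   orbits (infinitely many if [i = 0]). *)
Definition typed (E F O : nat -> nat -> Prop) (i u m : nat) : Prop :=
  (E u m /\ count_is (orbits F O m) i) /\ leader F m.

Section NestedOrbits.
Variables (E F : nat -> nat -> Prop) (s : nat -> nat).
Hypothesis nest : nested_successor E F s.

Let O := orbit_of s.

Lemma orbit_inner x y : O x y -> F x y.
Proof.
have [_ [rF sF tF] _ Fs _ _ _] := nest.
have Fi n z : F z (iter n s z).
  by elim: n => [|n IH]; [exact: rF|exact: (tF _ _ _ IH (Fs _))].
by move=> [n [->|->]] //; exact: sF.
Qed.

Lemma nested_orbit_equiv : equivalence O.
Proof.
by have [_ _ _ _ [t st ts] acs _] := nest; exact: (orbit_equiv st ts).
Qed.

Lemma orbits_inner m m' o : F m m' -> orbits F O m o <-> orbits F O m' o.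
Proof.
have [_ [rF sF tF] _ _ _ _ _] := nest.
move=> mm'; split=> -[mo Lo]; split=> //; last exact: (tF _ _ _ mm' mo).
exact: (tF _ _ _ (sF _ _ mm') mo).
Qed.

Lemma orbits_type m : exists i, count_is (orbits F O m) i.
Proof.
apply: count_is_total.
have [rep [repL repR _ _]] := leader_exists nested_orbit_equiv.
by exists (rep m); split=> //; exact: orbit_inner.
Qed.

End NestedOrbits.

Lemma nested_iso_typed E F s E' F' s' h :
  nested_successor E F s -> nested_successor E' F' s' -> bijective h ->
  (forall x y, E x y <-> E' (h x) (h y)) ->
  (forall x y, F x y <-> F' (h x) (h y)) -> (forall x, h (s x) = s' (h x)) ->
  exists f g, bij_on (leader E) (leader E') f g /\ forall i u, leader E u ->
    exists f' g', bij_on (typed E F (orbit_of s) i u)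
                         (typed E' F' (orbit_of s') i (f u)) f' g'.
Proof.
move=> nest nest' [k hk kh] hE hF hs.
have [eE eF FE _ _ _ _] := nest; have [eE' eF' FE' _ _ _ _] := nest'.
have [rE sE tE] := eE; have [rE' sE' tE'] := eE'.
have [rF sF tF] := eF; have [rF' sF' tF'] := eF'.
have hiter n x : h (iter n s x) = iter n s' (h x).
  by elim: n => //= n IH; rewrite hs IH.
have hO x y : orbit_of s x y <-> orbit_of s' (h x) (h y).
  split=> -[n H]; exists n; first by case: H => ->; rewrite hiter; [left|right].
  by case: H; rewrite -hiter => /(can_inj hk); [left|right].
have orbits_bij m : exists f g,
    bij_on (orbits F (orbit_of s) m) (orbits F' (orbit_of s') (h m)) f g.
  have [|||f [g [fg _]]] := @leader_bij _ _ (F m) (F' (h m)) h k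
    (nested_orbit_equiv nest) (nested_orbit_equiv nest') hk kh hO.
  - by move=> x y /(orbit_inner nest) xy mx; exact: (tF _ _ _ mx xy).
  - by move=> x y /(orbit_inner nest') xy mx; exact: (tF' _ _ _ mx xy).
  - by move=> x; exact: hF.
  by exists f, g.
have countE A B i : (forall x, A x <-> B x) -> count_is A i -> count_is B i.
  by move=> AB; apply: (@count_is_bij_on _ _ id id); split=> x /AB.
have hcount m i : count_is (orbits F (orbit_of s) m) i <->
    count_is (orbits F' (orbit_of s') (h m)) i.
  have [f [g fg]] := orbits_bij m.
  by split; apply: count_is_bij_on; [exact: fg|exact: bij_onC fg].
(* With trivial predicates this matches all outer classes; [hf] places [f u] in the class of [h u],
   which identifies the inner classes over [f u] below. *)
have [|||f [g [fg hf]]] := @leader_bij _ _ (fun=> True) (fun=> True) h k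
  eE eE' hk kh hE => //.
exists f, g; split; first by apply: bij_on_iff fg => x; split=> [[]|].
move=> i u Lu.
have [|||f' [g' [fg' _]]] := @leader_bij _ _
  (fun m => E u m /\ count_is (orbits F (orbit_of s) m) i)
  (fun m => E' (f u) m /\ count_is (orbits F' (orbit_of s') m) i) h k eF eF' hk kh hF.
- move=> x y xy [ux cx]; split; first exact: (tE _ _ _ ux (FE _ _ xy)).
  by apply: countE cx => o; exact: orbits_inner nest _ _ _ xy.
- move=> x y xy [ux cx]; split; first exact: (tE' _ _ _ ux (FE' _ _ xy)).
  by apply: countE cx => o; exact: orbits_inner nest' _ _ _ xy.
- move=> x; split=> -[ux cx]; split; try exact/hcount.
    by apply: (tE' _ _ _ (sE' _ _ (hf u))); apply/hE.
  by apply/hE; exact: (tE' _ _ _ (hf u)).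
by exists f', g'.
Qed.

(** Built downwards by repeated use of [bij_on_glue]: [psi] on inner classes over [f], [chi] on
    orbits over [psi], and [h] on points over [chi]. Agreement of types along [psi] is what makes
    [chi] possible. *)
Lemma typed_nested_iso E F s E' F' s' f g :
  nested_successor E F s -> nested_successor E' F' s' ->
  bij_on (leader E) (leader E') f g ->
  (forall i u, leader E u ->
    exists f' g', bij_on (typed E F (orbit_of s) i u)
                         (typed E' F' (orbit_of s') i (f u)) f' g') ->
  exists h, [/\ bijective h, forall x y, E x y <-> E' (h x) (h y),
    forall x y, F x y <-> F' (h x) (h y) & forall x, h (s x) = s' (h x)].
Proof.
move=> nest nest' fg fiber.
have [eE eF FE _ [t st ts] acs _] := nest.
have [eE' eF' FE' _ [t' st' ts'] acs' _] := nest'.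
have eO := nested_orbit_equiv nest; have eO' := nested_orbit_equiv nest'.
have [repE [EL ER EP EI]] := leader_exists eE.
have [repE' [EL' ER' EP' EI']] := leader_exists eE'.
have [repF [FL FR FP FI]] := leader_exists eF.
have [repF' [FL' FR' FP' FI']] := leader_exists eF'.
have [repO [OL OR OP OI]] := leader_exists eO.
have [repO' [OL' OR' OP' OI']] := leader_exists eO'.
have to R (rep : nat -> nat) x : (forall x y, R x y <-> rep x = rep y) ->
    (forall x, leader R x -> rep x = x) ->
    leader R x -> forall y, R x y <-> rep y = x.
  by move=> RP RI Lx y; rewrite RP RI //; split.
have toE x := to _ _ x EP EI; have toE' x := to _ _ x EP' EI'.
have toF x := to _ _ x FP FI; have toF' x := to _ _ x FP' FI'.
have toO x := to _ _ x OP OI; have toO' x := to _ _ x OP' OI'.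
have /choice[typ typP] := orbits_type nest.
have /choice[typ' typP'] := orbits_type nest'.
have typE m i : count_is (orbits F (orbit_of s) m) i <-> typ m = i.
  by split=> [|<-//]; exact: count_is_unique.
have typE' m i : count_is (orbits F' (orbit_of s') m) i <-> typ' m = i.
  by split=> [|<-//]; exact: count_is_unique.
have classes u : leader E u -> exists f' g',
    (forall m, E u m /\ leader F m -> typ' (f' m) = typ m) /\
    bij_on (fun m => leader F m /\ repE m = u)
           (fun m => leader F' m /\ repE' m = f u) f' g'.
  move=> Lu; have Lfu := proj1 (proj1 fg u Lu).
  (* Inside one outer class the gluing runs over the identity of the set of types, since every inner
     class has exactly one type. *)
  have [||||f' [g' [fg' ft _]]] := @bij_on_glue
    (fun m => E u m /\ leader F m) (fun m => E' (f u) m /\ leader F' m)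
    (fun=> True) (fun=> True) typ typ' id id (fun _ _ => True) => //.
    move=> i _; have [f' [g' fg']] := fiber i u Lu; exists f', g'; split=> //.
    by apply: bij_on_iff fg' => m; rewrite /typed ?typE ?typE'; tauto.
  exists f', g'; split=> //.
  by apply: bij_on_iff fg' => m; [rewrite (toE _ Lu)|rewrite (toE' _ Lfu)]; tauto.
have [||psi [psi' [psiK psiE psit]]] := @bij_on_glue (leader F) (leader F')
  (leader E) (leader E') repE repE' f g _ fg _ _ classes => //.
have {}psit m : leader F m -> typ' (psi m) = typ m.
  move=> Lm; have [f' ft fE] := psit _ (EL m); rewrite fE // ft //.
  by split=> //; apply/EP; rewrite EI.
have [|||chi [chi' [chiK chiF _]]] := @bij_on_glue
  (leader (orbit_of s)) (leader (orbit_of s')) (leader F) (leader F')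
  repF repF' psi psi' (fun _ _ => True) psiK => //.
  move=> m Lm; have Lpm := proj1 (proj1 psiK m Lm).
  have [f' [g' fg']] : exists f' g', bij_on (orbits F (orbit_of s) m)
      (orbits F' (orbit_of s') (psi m)) f' g'.
    (* Inner classes of equal type have equally many orbits. *)
    by apply: (count_is_equipotent (typP m)); apply/typE'; exact: psit.
  exists f', g'; split=> //.
  by apply: bij_on_iff fg' => o; rewrite /orbits;
    [rewrite (toF _ Lm)|rewrite (toF' _ Lpm)]; tauto.
(* Here [Z] retains commutation with the successor, which is needed after gluing. *)
have [|||h [h' [[hK hK'] hO hs]]] := @bij_on_glue (fun=> True) (fun=> True)
  (leader (orbit_of s)) (leader (orbit_of s')) repO repO' chi chi'
  (fun o f => forall x, orbit_of s o x -> f (s x) = s' (f x)) chiK => //.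
  move=> o Lo; have Lco := proj1 (proj1 chiK o Lo).
  have [f' [g' [fs fg']]] := orbit_bij o (chi o) st ts acs st' ts' acs'.
  exists f', g'; split=> //.
  by apply: bij_on_iff fg' => x; [rewrite (toO _ Lo)|rewrite (toO' _ Lco)]; tauto.
have repFO x : repF (repO x) = repF x.
  by apply/esym/FP/(orbit_inner nest).
have repFO' x : repF' (repO' x) = repF' x.
  by apply/esym/FP'/(orbit_inner nest').
have repEF x : repE (repF x) = repE x by apply/esym/EP/FE.
have repEF' x : repE' (repF' x) = repE' x by apply/esym/EP'/FE'.
have hF x : repF' (h x) = psi (repF x) by rewrite -repFO' hO // chiF // repFO.
have hE x : repE' (h x) = f (repE x) by rewrite -repEF' hF psiE // repEF.
exists h; split.
- by exists h' => x; [have [] := hK x I|have [] := hK' x I].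
- move=> x y; rewrite EP EP' !hE; split=> [->//|e].
  by have [_ <-] := proj1 fg _ (EL x); rewrite e; have [] := proj1 fg _ (EL y).
- move=> x y; rewrite FP FP' !hF; split=> [->//|e].
  by have [_ <-] := proj1 psiK _ (FL x); rewrite e; have [] := proj1 psiK _ (FL y).
move=> x; have [f' fs' fE] := hs _ (OL x).
rewrite !fE // ?fs' //; first by apply/OP; rewrite OI.
by apply/esym/OP/orbit_succ.
Qed.

(** Iterates of the successor in terms of its graph: they make sense in every structure, where no
    function need exist, and unfold to countable unions of atomic facts. *)
Fixpoint step_iter (S : nat -> nat -> Prop) n x y : Prop :=
  if n is n'.+1 then exists z, S x z /\ step_iter S n' z y else x = y.

Definition orbit_rel (S : nat -> nat -> Prop) (x y : nat) : Prop :=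
  exists n, step_iter S n x y \/ step_iter S n y x.

Lemma orbit_relE S s : (forall x y, S x y <-> y = s x) ->
  orbit_rel S = orbit_of s.
Proof.
move=> SE.
have iterE n x y : step_iter S n x y <-> y = iter n s x.
  elim: n x => [|n IH] x /=; first by split.
  rewrite -iterS iterSr; split=> [[z [/SE-> /IH]]//|yx].
  by exists (s x); split; [exact/SE|exact/IH].
apply/funext => x; apply/funext => y; apply/propext; rewrite /orbit_rel.
by split=> -[n H]; exists n; move: H; rewrite !iterE.
Qed.

Lemma leader_infinite E F s : nested_successor E F s -> forall n,
  exists2 a : 'I_n -> nat, injective a & forall i, leader E (a i).
Proof.
move=> nest n; have [eE _ _ _ _ _ /(_ n)[a aE]] := nest.
have [rep [repL _ repE _]] := leader_exists eE.
exists (rep \o a) => [i j /repE aij|i]; last exact: repL.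
by apply: contrapT => /eqP/aE.
Qed.

(** * The reduction map and its Borelness *)

Section BorelReduction.

Local Notation JJ := (jump_language (jump_language succ_language)).

Definition reduct (M : omega_structure JJ) : omega_structure K_language :=
  coded (leader (outer_rel M))
    (typed (outer_rel M) (inner_rel M) (orbit_rel (step_rel M))).

Lemma reduct_models (M : Mod T2) : models (reduct M) K.
Proof.
have [s nest _] := T2_nested (svalP M).
exact/coded_models/(leader_infinite nest).
Qed.

Definition reduction (M : Mod T2) : Mod K := exist _ (reduct M) (reduct_models M).

Lemma reduction_iso (M N : Mod T2) :
  isomorphic M N <-> isomorphic (reduction M) (reduction N).
Proof.
have [s nest SE] := T2_nested (svalP M); have [s' nest' SE'] := T2_nested (svalP N).
apply: iff_trans (isomorphic_T2 _ _) (iff_trans _ (iff_sym (isomorphic_coded _ _ _ _))).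
rewrite (orbit_relE SE) (orbit_relE SE'); split=> [[h [bh hR]]|[f [g [fg fib]]]].
  apply: (nested_iso_typed nest nest' bh) => [x y|x y|x]; try by case: (hR x y).
  by apply/SE'; have [_ _ <-] := hR x (s x); apply/SE.
have [h [bh hE hF hs]] := typed_nested_iso nest nest' fg fib.
exists h; split=> // x y; split=> //.
rewrite SE SE' -hs; split=> [->//|]; exact: bij_inj.
Qed.

Lemma borel_leader (R : omega_structure JJ -> nat -> nat -> Prop) x :
  (forall x y, borel_set (fun M : Mod T2 => R M x y)) ->
  borel_set (fun M : Mod T2 => leader (R M) x).
Proof.
move=> bR; apply: borel_forall => y; apply: borel_imp; first exact: borel_const.
exact: borel_not.
Qed.

(** Finiteness and exact size are witnessed by lists of naturals, of which there are countably
    many. *)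
Lemma borel_count_is (A : omega_structure JJ -> nat -> Prop) i :
  (forall x, borel_set (fun M : Mod T2 => A M x)) ->
  borel_set (fun M : Mod T2 => count_is (A M) i).
Proof.
move=> bA; case: i => [|i].
  apply: borel_not; apply: borel_exists => l; apply: borel_forall => x.
  by apply: borel_imp => //; exact: borel_const.
have -> : (fun M : Mod T2 => count_is (A M) i.+1) = (fun M => exists l : seq nat,
    (uniq l /\ size l = i.+1) /\ forall x, x \in l <-> A M x).
  by apply/funext => M; apply/propext; split=> -[l]; [case|case=> -[]]; exists l.
apply: borel_exists => l; apply: borel_and; first exact: borel_const.
by apply: borel_forall => x; apply: borel_iff => //; exact: borel_const.
Qed.

Let borel_outer x y : borel_set (fun M : Mod T2 => outer_rel M x y).
Proof. exact: borel_fact. Qed.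

Let borel_inner x y : borel_set (fun M : Mod T2 => inner_rel M x y).
Proof. exact: borel_fact. Qed.

Let borel_step x y : borel_set (fun M : Mod T2 => step_rel M x y).
Proof. exact: borel_fact. Qed.

Let borel_orbit x y : borel_set (fun M : Mod T2 => orbit_rel (step_rel M) x y).
Proof.
have bi n : forall x y, borel_set (fun M : Mod T2 => step_iter (step_rel M) n x y).
  elim: n => [|n IH] {}x {}y; first exact: (borel_const (x = y)).
  by apply: borel_exists => z; apply: borel_and.
by apply: borel_exists => n; apply: borel_or.
Qed.

Let reduct_valid (M : omega_structure JJ) : code -> Prop :=
  valid (leader (outer_rel M))
    (typed (outer_rel M) (inner_rel M) (orbit_rel (step_rel M))).

Lemma borel_valid t : borel_set (fun M : Mod T2 => reduct_valid M t).
Proof.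
have bU u := borel_leader u borel_outer.
case: t => [u|i b|i c u o z]; first exact: bU.
  exact: (borel_const True).
have -> : (fun M : Mod T2 => reduct_valid M (CV i c u o z)) = (fun M =>
    size c = i.+1 /\ (leader (outer_rel M) u /\ if o is Some m then
      typed (outer_rel M) (inner_rel M) (orbit_rel (step_rel M)) i u m else True)).
  by apply/funext => M; apply/propext; split=> [[]|[? []]].
apply: borel_and; first exact: borel_const.
apply: borel_and => //; case: o => [m|]; last exact: borel_const.
apply: borel_and; last exact: borel_leader borel_inner.
apply: borel_and => //.
apply: (borel_count_is
  (A := fun M => orbits (inner_rel M) (orbit_rel (step_rel M)) m)) => o.
apply: borel_and => //.
exact: (borel_leader (R := fun M => orbit_rel (step_rel M))).
Qed.

Lemma borel_reduction : borel_map reduction.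
Proof.
have bV := borel_valid.
have bR t n : borel_set (fun M : Mod T2 => rank (reduct_valid M) t = n).
  exact: (@borel_rank (Mod T2) code (fun M : Mod T2 => reduct_valid M)).
apply: borel_map_facts => -[n k|f a b|[]].
  (* [enum_code] rests on choice; it is replaced by quantification over the valid codes of rank [n],
     which makes the fact a countable union of Borel conditions on ranks. *)
  have -> : (fun M => fact_holds (reduction M) (SortFact n k)) = (fun M =>
      exists t, (reduct_valid M t /\ rank (reduct_valid M) t = n) /\ code_sort t = k).
    apply/funext => M; apply/propext; split=> [<-|[t [[vt <-] <-]]] /=.
      by eexists; split; [split; [exact: enum_valid|exact: enum_codeK]|].
    by rewrite /coded_sort rankK.
  apply: borel_exists => t; apply: borel_and; first exact: borel_and.
  exact: borel_const.
(* The functions act on codes independently of [M]; only the numbering of argument and value varies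
   with the model. *)
have -> : (fun M => fact_holds (reduction M) (@FunFact K_language f a b)) = (fun M =>
    exists t, (reduct_valid M t /\ rank (reduct_valid M) t = a (@ord0 0)) /\
      (code_sort t = Kdom f /\ rank (reduct_valid M) (code_fun f t) = b)).
  apply/funext => M; apply/propext; split=> [[c [ca <-]]|[t [[vt ta] [tf <-]]]].
    exists (decode (c (@ord0 0))); split; first split.
    - exact: decode_valid.
    - by rewrite -ca; exact: enum_codeK.
    - by split=> //; rewrite decode_sort; exact: fdom_Kdom.
  pose c (i : 'I_(farity f)) : reduct M (fdom f i) :=
    encode vt (etrans tf (esym (fdom_Kdom i))).
  exists c; split=> [i|]; first by rewrite /= -/(reduct_valid M) ta (ord1 i).
  by rewrite /= encodeK.
apply: borel_exists => t; apply: borel_and; first exact: borel_and.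
by apply: borel_and => //; exact: borel_const.
Qed.

End BorelReduction.

Theorem proposition6p5 : borel_reducible T2 K.
Proof.
by exists reduction; split; [exact: borel_reduction|exact: reduction_iso].
Qed.
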